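(* Let $A\in\mathscr{R}$ be fixed and let $r>0$. Let $\{\mathbf{X}^{(i)}, i\in\mathbb{N}\}$ be identically distributed copies of a random vector $\mathbf{X}$ with distribution $F$ supported on $[0,\infty)^d$, such that the sequences $\{\mathbf{X}^{(i)}, i\in\mathbb{N}\}$ and $\{\tau_i, i\in\mathbb{N}\}$ are independent of each other. Suppose that $F\in(\mathcal{C}\cap\mathcal{P_D})_A$, and that there exist $q_1,q_2$ with $0<q_1<J_{F_A}^-\le J_{F_A}^+<q_2<\infty$ such that $$\sum_{i=1}^{\infty}\left(\max\left\{\mathbf{E}\left[e^{-q_1r\tau_i}\right],\ \mathbf{E}\left[e^{-q_2r\tau_i}\right]\right\}\right)^{1/q}<\infty,$$ where $q=\mathbf{1}_{\{0<J_{F_A}^+<1\}}+q_2\,\mathbf{1}_{\{J_{F_A}^+\ge1\}}$. Suppose that $\{\mathbf{X}^{(i)}, i\in\mathbb{N}\}$ is quasi asymptotically independent on $A$ ($QAI_A$), and moreover that $F\in MRV(\alpha,\mu)$ with $\alpha\in(0,\infty)$ and with associated normalizing distribution $V\in\mathcal{R}_{-\alpha}$. Then, as $x\to\infty$, $$\mathbf{P}\left(\mathbf{D}(\infty)\in xA\right)\sim\mu(A)\,\overline V(x)\int_0^\infty e^{-\alpha rs}\,m(ds).$$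
   Context: Fix $d\in\mathbb{N}$. The relation $f(x)\sim g(x)$ means $f(x)/g(x)\to1$ as $x\to\infty$; all limits inferior/superior below are as $x\to\infty$ unless indicated. A set $B\subset\mathbb{R}^d$ is increasing if $\mathbf{b}+\mathbf{z}\in B$ for all $\mathbf{b}\in B$, $\mathbf{z}\in[0,\infty)^d$. $\mathscr{R}$ is the family of all $A\subset\mathbb{R}^d$ that are open, increasing, with $A^c$ convex and $\mathbf{0}\notin\overline{A}$. Claim vectors: each $\mathbf{X}^{(i)}$ takes values in $[0,\infty)^d$; some components may be zero, but not all components are zero. Counting process: $0\le\tau_1\le\tau_2\le\dots$ are random claim arrival times, $N(t)=\sup\{i\in\mathbb{N}:\tau_i\le t\}$ ($\sup\emptyset=0$), $N(\infty)=\infty$, and $m(t)=\mathbf{E}[N(t)]=\sum_{i\ge1}\mathbf{P}(\tau_i\le t)$ is assumed finite for every fixed $t\ge0$; $m(ds)$ denotes the corresponding mean measure $\sum_i\mathbf{P}(\tau_i\in ds)$ on $[0,\infty)$. Discounted aggregate claims: $\mathbf{D}(\infty)=\sum_{i=1}^{\infty}\mathbf{X}^{(i)}e^{-r\tau_i}$. For $A\in\mathscr{R}$ and a random vector $\mathbf{Z}$ in $[0,\infty)^d$ with distribution $G$, put $Z_A=\sup\{u>0:\mathbf{Z}\in uA\}$ ($\sup\emptyset=0$) and let $G_A$ be its distribution; then $\overline{G_A}(x)=1-G_A(x)=\mathbf{P}(\mathbf{Z}\in xA)$ for $x>0$. $G\in(\mathcal{C}\cap\mathcal{P_D})_A$ means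 $G_A\in\mathcal{C}\cap\mathcal{P_D}$, where, for a one-dimensional distribution $V$ with $\overline V(x)=1-V(x)>0$ for all $x$: $V\in\mathcal{C}$ (consistently varying) if $\lim_{b\uparrow1}\limsup\overline V(bx)/\overline V(x)=1$; $V\in\mathcal{P_D}$ (positively decreasing) if $\limsup\overline V(vx)/\overline V(x)<1$ for any (equivalently some) $v>1$. Matuszewska indices of $V$: $J_V^+=-\lim_{v\to\infty}\log\overline V_*(v)/\log v$ and $J_V^-=-\lim_{v\to\infty}\log\overline V^*(v)/\log v$, where $\overline V_*(v)=\liminf\overline V(vx)/\overline V(x)$ and $\overline V^*(v)=\limsup\overline V(vx)/\overline V(x)$. $QAI_A$: nonnegative random variables $\{Z_i\}$ with distributions $\{G_i\}$ are quasi asymptotically independent ($QAI$) if $\lim_{x\to\infty}\mathbf{P}(Z_i>x,Z_j>x)/(\overline{G_i}(x)+\overline{G_j}(x))=0$ for all $i\ne j$. Random vectors $\{\mathbf{Z}^{(i)}\}$ in $[0,\infty)^d$ are $QAI_A$ if the random variables $Z_A^{(i)}=\sup\{u>0:\mathbf{Z}^{(i)}\in uA\}$ are $QAI$. Multivariate regular variation: a one-dimensional distribution $V$, with tail $\overline V=1-V$, is in $\mathcal{R}_{-\alpha}$ if $\lim_{x\to\infty}\overline V(tx)/\overline V(x)=t^{-\alpha}$ for all $t>0$. $F\in MRV(\alpha,\mu)$ means that there exist $V\in\mathcal{R}_{-\alpha}$, $\alpha\in(0,\infty)$, and a Radon measure $\mu$ on $[-\infty,\infty]^d\setminus\{\mathbf{0}\}$,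 not identically zero, such that $\lim_{x\to\infty}\mathbf{P}(\mathbf{X}\in xB)/\overline V(x)=\mu(B)$ for every Borel set $B\subseteq[-\infty,\infty]^d\setminus\{\mathbf{0}\}$ bounded away from $\mathbf{0}$ with $\mu(\partial B)=0$.
   Formalization: When μ(A)=0 the right-hand side vanishes and the relation ~ (ratio tending to 1) is meaningless; the formal theorem proves the ratio limit for μ(A)≠0 and, for μ(A)=0, that P(D(∞)∈xA)=o(V̄(x)). *)

(* Defs.v *)
From HB Require Import structures.
From mathcomp Require Import all_boot all_order all_algebra.
From mathcomp Require Import all_classical all_reals all_analysis.

Set Implicit Arguments.
Unset Strict Implicit.
Unset Printing Implicit Defensive.

Import Order.TTheory GRing.Theory Num.Theory.
Import numFieldNormedType.Exports.

Local Open Scope classical_set_scope.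
Local Open Scope ring_scope.

Definition borelRV (R : realType) (d : nat) :=
  g_sigma_algebraType (@open 'rV[R]_d).

Definition borelERV (R : realType) (d : nat) :=
  g_sigma_algebraType (@open 'rV[\bar R]_d).

Section sets.
Context {R : realType} {d : nat}.

Definition increasing_set (B : set 'rV[R]_d) : Prop :=
  forall b z : 'rV[R]_d, B b -> (forall j, 0 <= z 0 j) -> B (b + z).

Definition ruin_set (A : set 'rV[R]_d) : Prop :=
  [/\ open A, increasing_set A, convex_set (~` A) & ~ closure A 0].

Definition dilate (u : R) (A : set 'rV[R]_d) : set 'rV[R]_d :=
  [set u *: a | a in A].

(* Z_A = sup {u > 0 : Z \in uA}; [sup set0] is 0 in the library. *)
Definition radius_on (A : set 'rV[R]_d) (z : 'rV[R]_d) : R :=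
  sup [set u | 0 < u /\ dilate u A z].

Definition embed (z : 'rV[R]_d) : 'rV[\bar R]_d := map_mx (@EFin R) z.

Definition edilate (u : R) (B : set 'rV[\bar R]_d) : set 'rV[\bar R]_d :=
  [set map_mx (fun y => u%:E * y)%E b | b in B].

End sets.

Section tails.
Context {R : realType}.

(* 1 - G(x) for G the law of Z under P: the classes of one-dimensional
   distributions below depend on the distribution only through this function.
   A law V on R has tail [tail V idfun]; F_A has tail [tail F (radius_on A)]. *)
Definition tail {T : Type} (P : set T -> \bar R) (Z : T -> R) (x : R) : R :=
  fine (P [set w | x < Z w]).

Implicit Type G : R -> R.

Definition upper_ratio G (v : R) : \bar R :=
  limf_esup (fun x => (G (v * x) / G x)%:E) (pinfty_nbhs R).

Definition lower_ratio G (v : R) : \bar R :=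
  limf_einf (fun x => (G (v * x) / G x)%:E) (pinfty_nbhs R).

Definition consistently_varying G : Prop :=
  (forall x, 0 < G x) /\ upper_ratio G b @[b --> (1 : R)^'-] --> 1%E.

(* "for some v > 1": the weaker of the two readings in use *)
Definition positively_decreasing G : Prop :=
  (forall x, 0 < G x) /\ exists2 v, 1 < v & (upper_ratio G v < 1)%E.

(* [lne 0] is -oo, so the indices may be +oo. *)
Definition matuszewska_upper G : \bar R :=
  (- lim ((lne (lower_ratio G v) / (ln v)%:E) @[v --> pinfty_nbhs R]))%E.

Definition matuszewska_lower G : \bar R :=
  (- lim ((lne (upper_ratio G v) / (ln v)%:E) @[v --> pinfty_nbhs R]))%E.

Definition regularly_varying (alpha : R) G : Prop :=
  forall t, 0 < t -> G (t * x) / G x @[x --> pinfty_nbhs R] --> t `^ (- alpha).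

(* f ~ g. When g = c h with c = 0 the quotient is meaningless and f ~ c h is
   read as f = o(h), which is [asymp_negligible f h]. *)
Definition asymp_equiv (f g : R -> \bar R) : Prop :=
  (f x / g x)%E @[x --> pinfty_nbhs R] --> 1%E.

Definition asymp_negligible (f h : R -> \bar R) : Prop :=
  (f x / h x)%E @[x --> pinfty_nbhs R] --> 0%E.

End tails.

Section mrv.
Context {R : realType} {d : nat}.

(* A measure on [-oo,+oo]^d \ {0} is given by its extension by zero to
   [-oo,+oo]^d. Compact subsets of the punctured space are the compact sets
   that avoid 0; as that space is locally compact with a countable base, a
   Borel measure finite on them is Radon. *)
Definition punctured_radon (mu : set (borelERV R d) -> \bar R) : Prop :=
  mu [set 0] = 0%E /\
  forall K : set 'rV[\bar R]_d, compact K -> ~ K 0 -> (mu K < +oo)%E.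

Definition eboundary (B : set 'rV[\bar R]_d) : set 'rV[\bar R]_d :=
  closure B `\` interior B.

(* F \in MRV(alpha, mu), with V the normalizing distribution *)
Definition MRV (F : probability (borelRV R d) R) (alpha : R)
    (mu : {measure set (borelERV R d) -> \bar R})
    (V : probability (measurableTypeR R) R) : Prop :=
  [/\ 0 < alpha,
      regularly_varying alpha (tail V idfun),
      punctured_radon mu,
      mu setT != 0%E &
      forall B : set (borelERV R d), measurable B ->
        ~ closure (B : set 'rV[\bar R]_d) 0 -> mu (eboundary B) = 0%E ->
        (F (embed @^-1` edilate x B) / (tail V idfun x)%:E)%E
          @[x --> pinfty_nbhs R] --> mu B].

End mrv.

Section probability.
Context {R : realType} {dT : measure_display} {T : measurableType dT}.
Variable P : probability T R.

Definition sigma_of_seq {dU : measure_display} {U : measurableType dU}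
    (Y : nat -> T -> U) : set_system T :=
  <<s \bigcup_i preimage_set_system setT (Y i) measurable >>.

Definition independent_seqs {dU dW : measure_display} {U : measurableType dU}
    {W : measurableType dW} (Y : nat -> T -> U) (Z : nat -> T -> W) : Prop :=
  forall E1 E2, sigma_of_seq Y E1 -> sigma_of_seq Z E2 ->
    P (E1 `&` E2) = (P E1 * P E2)%E.

Definition QAI (Z : nat -> T -> R) : Prop :=
  forall i j, i != j ->
    fine (P [set w | x < Z i w /\ x < Z j w]) / (tail P (Z i) x + tail P (Z j) x)
      @[x --> pinfty_nbhs R] --> (0 : R).

Definition QAI_on {d : nat} (A : set 'rV[R]_d) (X : nat -> T -> 'rV[R]_d) : Prop :=
  QAI (fun i w => radius_on A (X i w)).

(* The sequences are indexed from 0: [tau i] is the arrival time number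
   [i.+1]. The element 0 accounts for sup of the empty set. *)
Definition claim_count (tau : nat -> T -> R) (t : R) (w : T) : \bar R :=
  ereal_sup (0%E |` [set (i.+1)%:R%:E | i in [set i | tau i w <= t]]).

(* m(ds) = \sum_i P(tau_i \in ds) *)
Definition mean_measure (tau : nat -> {RV P >-> measurableTypeR R}) :=
  mseries (fun i => distribution P (tau i)) 0.

(* The components may a priori be +oo. *)
Definition discounted_claims {d : nat} (r : R) (X : nat -> T -> 'rV[R]_d)
    (tau : nat -> T -> R) (w : T) : 'rV[\bar R]_d :=
  \row_j (\sum_(0 <= i <oo) (X i w 0 j * expR (- (r * tau i w)))%:E)%E.

End probability.

(* Main.v *)
(* Since A is open and increasing with convex complement, and 0 is not in its
   closure, z lies in xA exactly when the radius Z_A of z exceeds x, and the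
   radius is monotone, homogeneous and subadditive.  Hence the ruin event lies
   between the event that some discounted radius W_i exp(- r tau_i) exceeds x and the
   event that the sum of the discounted radii exceeds x.

   For finitely many terms a single big jump dominates: QAI_A kills the joint
   exceedances (Bonferroni from below), and Breiman's lemma evaluates each
   summand.  The remaining series is negligible uniformly in x: the Matuszewska
   indices give Potter bounds, which control the moment of order q of the
   radii truncated at x, and Jensen's inequality with weights
   E[exp(- q1 r tau_i)]^(1/q) sums them (the maximum in the hypothesis is its
   q1-term, because q1 < q2).

   Multivariate regular variation gives F_A / V -> mu(A): the boundaries of the
   dilates of A are disjoint up to infinite points, so all but countably many
   are mu-null, along which mu(tA) = t^(- alpha) mu(A); monotonicity extends
   the limit to every dilate.  The same scaling shows that infinite points have
   mass 0.  If mu(A) = 0, the upper bound O(F_A) = o(V) suffices. *)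

Require Import Defs.
From HB Require Import structures.
From mathcomp Require Import finmap.
From mathcomp Require Import all_boot all_order all_algebra.
From mathcomp Require Import all_classical all_reals all_analysis.
From mathcomp Require Import measurable_realfun.
From mathcomp Require Import ring lra.
Import Order.TTheory GRing.Theory Num.Theory.
Import numFieldNormedType.Exports.
Set Implicit Arguments.
Unset Strict Implicit.
Unset Printing Implicit Defensive.
Local Open Scope classical_set_scope.
Local Open Scope ring_scope.

(** * Matuszewska indices and Potter bounds *)

(** Apart from [QAI] of pairs, the dependence among the claims is arbitrary, so the remainder of the
    series has to be estimated from marginal laws alone; convexity of the power q takes the place of
    independence. As q exceeds J+, a full moment of order q may be infinite. Truncating every term
    at x keeps a sum that exceeds x at least equal to x, and makes the moment comparable with
    F_A(x): a Potter exponent p strictly between J+ and q turns its dyadic layers into a convergent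
    geometric series.

    The lower bound meets another obstacle. Points in the image of [dilate x A] under [embed] are
    finite, so a large radius causes ruin only where all components of the discounted sum are
    finite, and the radius need not control every component (A may constrain only some of them).
    Here regular variation enters a second time: the largest component has tail O(V), and V = O(F_A)
    once mu(A) > 0. The series bound is therefore stated for any variables with tail O(F_A) and is
    applied to the radii and to the components. When mu(A) > 0, F_A also inherits the index alpha
    from V, as Breiman's lemma requires. *)

Section indices.
Context {R : realType}.
Implicit Type G : R -> R.

Lemma upper_ratio_near G v c : (upper_ratio G v < c%:E)%E ->
  \forall x \near +oo, G (v * x) / G x <= c.
Proof.
rewrite /upper_ratio limf_esupE => /ereal_inf_lt[_ [B FB <-] Bc].
apply: filterS FB => x Bx; rewrite -lee_fin; apply: le_trans (ltW Bc).
by apply: ereal_sup_ubound; exists x.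
Qed.

Lemma lower_ratio_near G v c : (c%:E < lower_ratio G v)%E ->
  \forall x \near +oo, c <= G (v * x) / G x.
Proof.
rewrite /lower_ratio limf_einfE => /ereal_sup_gt[_ [B FB <-] Bc].
apply: filterS FB => x Bx; rewrite -lee_fin; apply: le_trans (ltW Bc) _.
by apply: ereal_inf_lbound; exists x.
Qed.

Lemma lne_lt_powR (u : \bar R) v c : 1 < v ->
  (lne u / (ln v)%:E < c%:E)%E -> (u < (v `^ c)%:E)%E.
Proof.
move=> v1; have lnv : 0 < ln v by rewrite ln_gt0.
have v0 : 0 < v by exact: lt_trans v1.
case: u => [u||]; last by rewrite ltNyr.
- have [u0 _|u0] := leP u 0.
    by rewrite lte_fin (le_lt_trans u0)// powR_gt0.
  rewrite lne_EFin// inver gt_eqF// -EFinM lte_fin ltr_pdivrMr// => lec.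
  by rewrite lte_fin -(lnK u0) /powR gt_eqF// ltr_expR.
- by rewrite /= inver gt_eqF// gt0_mulye// ?lte_fin ?invr_gt0.
Qed.

Lemma lne_gt_powR (u : \bar R) v c : 1 < v ->
  (c%:E < lne u / (ln v)%:E)%E -> ((v `^ c)%:E < u)%E.
Proof.
move=> v1; have lnv : 0 < ln v by rewrite ln_gt0.
have v0 : 0 < v by exact: lt_trans v1.
case: u => [u||]; rewrite ?ltry//.
- have [u0|u0] := leP u 0.
    by rewrite le0_lneNy ?lee_fin// inver gt_eqF// gt0_mulNye// ?lte_fin ?invr_gt0.
  rewrite lne_EFin// inver gt_eqF// -EFinM lte_fin ltr_pdivlMr// => lec.
  by rewrite lte_fin -(lnK u0) /powR gt_eqF// ltr_expR.
- by rewrite /= inver gt_eqF// gt0_mulNye// ?lte_fin ?invr_gt0.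
Qed.

(* A non-convergent [lim] is 0, so a nonzero index is a genuine limit. *)
Lemma lime_neq0_cvg (f : R -> \bar R) :
  lim (f x @[x --> +oo%R]) != 0%E -> f x @[x --> +oo%R] --> lim (f x @[x --> +oo%R]).
Proof.
move=> l0; apply: contrapT => /dvgP lE; move/eqP : l0; apply; exact: lE.
Qed.

(** A bound at one scale [v] suffices, since the Potter bounds iterate it along the powers of [v].
    The assumption [0 < q] keeps the limit away from 0, the value of a divergent [lim]. *)
Lemma matuszewska_lower_near G q : 0 < q -> (q%:E < matuszewska_lower G)%E ->
  exists2 v, 1 < v & \forall x \near +oo, G (v * x) / G x <= v `^ (- q).
Proof.
move=> q0; rewrite /matuszewska_lower lteNr => lq.
have := @lime_neq0_cvg (fun v => lne (upper_ratio G v) / (ln v)%:E)%E.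
rewrite lt_eqF; last by rewrite (lt_trans lq)// lte_fin oppr_lt0.
move=> /(_ isT) cv.
have nv : \forall v \near +oo, (lne (upper_ratio G v) / (ln v)%:E < (- q)%:E)%E.
  exact: (cv _ (open_ereal_lt' lq)).
have [v [v1 vq]] := filter_ex (filterI (nbhs_pinfty_gt (num_real (1 : R))) nv).
by exists v => //; apply: upper_ratio_near; exact: lne_lt_powR.
Qed.

Lemma matuszewska_upper_near G q : (0 < matuszewska_upper G)%E ->
  (matuszewska_upper G < q%:E)%E ->
  exists2 v, 1 < v & \forall x \near +oo, v `^ (- q) <= G (v * x) / G x.
Proof.
rewrite /matuszewska_upper lteNr oppe0 lteNl => l0 lq.
have := @lime_neq0_cvg (fun v => lne (lower_ratio G v) / (ln v)%:E)%E.
rewrite lt_eqF// => /(_ isT) cv.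
have nv : \forall v \near +oo, ((- q)%:E < lne (lower_ratio G v) / (ln v)%:E)%E.
  exact: (cv _ (open_ereal_gt' lq)).
have [v [v1 vq]] := filter_ex (filterI (nbhs_pinfty_gt (num_real (1 : R))) nv).
by exists v => //; apply: lower_ratio_near; exact: lne_gt_powR.
Qed.

End indices.

Section potter.
Context {R : realType}.
Variable G : R -> R.
Hypothesis G_gt0 : forall x, 0 < G x.
Hypothesis G_le1 : forall x, G x <= 1.
Hypothesis G_mono : {homo G : x y /~ x <= y}.

Lemma geom_bracket (v y : R) : 1 < v -> 1 <= y ->
  exists k : nat, v ^+ k <= y < v ^+ k.+1.
Proof.
move=> v1 y1; have v0 : 0 < v by exact: lt_trans v1.
have lnv : 0 < ln v by rewrite ln_gt0.
have lny : 0 <= ln y / ln v by rewrite divr_ge0 ?ln_ge0// ltW.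
have y0 : 0 < y by exact: lt_le_trans y1.
exists (Num.truncn (ln y / ln v)).
have /andP[k1 k2] := truncn_itv lny.
rewrite -ler_ln ?posrE ?exprn_gt0// -ltr_ln ?posrE ?exprn_gt0// !lnXn//.
by rewrite -[leLHS]mulr_natl -[ltRHS]mulr_natl -ler_pdivlMr// -ltr_pdivrMr// k1.
Qed.

Lemma powRX (v q : R) k : 0 <= v -> (v ^+ k) `^ q = (v `^ q) ^+ k.
Proof.
move=> v0; elim: k => [|k IH]; first by rewrite !expr0 powR1.
by rewrite !exprS powRM ?exprn_ge0// IH.
Qed.

(** The one-step inequality is iterated along the powers of [v]. Rounding [th^-1] down to such a
    power costs at most a factor [v], whence the constant v^q. *)
Lemma potter_upper v q : 1 < v -> 0 <= q ->
  (\forall x \near +oo, G (v * x) / G x <= v `^ (- q)) ->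
  exists C x0, [/\ 0 < C, 0 < x0 & forall x th, x0 <= x -> 0 < th <= 1 ->
    G (x / th) <= C * th `^ q * G x].
Proof.
move=> v1 q0 [x0 [_ Hx0]]; have v0 : 0 < v by exact: lt_trans v1.
pose x1 := Num.max x0 0 + 1.
have x10 : 0 < x1 by rewrite ltr_wpDl// le_max lexx orbT.
have x1x0 : x0 < x1 by rewrite ltr_pwDr// le_max lexx.
have step k x : x1 <= x -> G (v ^+ k * x) <= (v `^ (- q)) ^+ k * G x.
  move=> x1x; elim: k => [|k IH]; first by rewrite !expr0 !mul1r.
  rewrite exprS -mulrA exprS -mulrA.
  apply: le_trans (ler_wpM2l (powR_ge0 _ _) IH).
  rewrite -ler_pdivrMr//; apply: Hx0.
  rewrite (lt_le_trans x1x0)// (le_trans x1x)// ler_peMl ?(le_trans (ltW x10))//.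
  by rewrite exprn_ege1// ltW.
exists (v `^ q), x1; split => //; first exact: powR_gt0.
move=> x th x1x /andP[th0 th1].
have thi : 1 <= th^-1 by rewrite invf_ge1.
have [k /andP[k1 k2]] := geom_bracket v1 thi.
have xx : 0 < x by exact: lt_le_trans x1x.
apply: (@le_trans _ _ (G (v ^+ k * x))).
  by apply: G_mono; rewrite mulrC ler_wpM2l// ltW.
apply: le_trans (step k x x1x) _; rewrite ler_wpM2r ?(ltW (G_gt0 _))//.
rewrite -powRM ?(ltW v0) ?(ltW th0)//.
have -> : (v `^ (- q)) ^+ k = (v ^- k) `^ q.
  by rewrite -exprVn powRX ?invr_ge0 ?(ltW v0)// -powR_inv1 ?(ltW v0)// -powRrM mulN1r.
apply: ge0_ler_powR; rewrite ?nnegrE ?exprn_ge0 ?invr_ge0 ?mulr_ge0 ?exprn_ge0 ?(ltW v0)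
  ?(ltW th0)//.
rewrite invf_ple ?posrE ?exprn_gt0 ?mulr_gt0// invfM.
by rewrite ler_pdivrMl// -exprS ltW.
Qed.

(** Downward iteration, with [l^-1] rounded up to a power of [v]; the difficulty is that [x] may
    leave the range of the one-step inequality on the way down. *)
Lemma potter_lower v p : 1 < v -> 0 <= p ->
  (\forall x \near +oo, v `^ (- p) <= G (v * x) / G x) ->
  exists C x0, [/\ 0 < C, 0 < x0 & forall x l, x0 <= x -> 0 < l <= 1 ->
    G (l * x) <= C * l `^ (- p) * G x].
Proof.
move=> v1 p0 [x0 [_ Hx0]]; have v0 : 0 < v by exact: lt_trans v1.
pose x1 := Num.max x0 0 + 1.
have x10 : 0 < x1 by rewrite ltr_wpDl// le_max lexx orbT.
have x1x0 : x0 < x1 by rewrite ltr_pwDr// le_max lexx.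
(* Once [x] is below [v * x1], monotonicity gives 1 <= c G(x), and [G <= 1] ends the iteration
   there. *)
pose c := (G (v * x1))^-1.
have c1 : 1 <= c by rewrite invf_ge1.
have step k x : x1 <= x -> G (x / v ^+ k) <= c * (v `^ p) ^+ k * G x.
  elim: k x => [x x1x|k IH x x1x].
    by rewrite !expr0 divr1 mulr1 ler_peMl// ltW.
  have [vx|xv] := leP (v * x1) x.
    have x1xv : x1 <= x / v by rewrite ler_pdivlMr// mulrC.
    rewrite exprS invfM mulrA; apply: le_trans (IH _ x1xv) _.
    have h : G (x / v) <= v `^ p * G x.
      have := Hx0 (x / v) (lt_le_trans x1x0 x1xv).
      rewrite (mulrC v) divfK ?gt_eqF// powRN ler_pdivlMr//.
      by rewrite ler_pdivrMl ?powR_gt0.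
    rewrite exprSr !mulrA -!mulrA ler_wpM2l ?(le_trans ler01)//.
    by rewrite ler_wpM2l ?exprn_ge0 ?powR_ge0.
  apply: (@le_trans _ _ 1) => //.
  rewrite mulrAC; apply: mulr_ege1; last first.
    by rewrite exprn_ege1// -(powRr0 v) ler_powR// ltW.
  rewrite /c mulrC ler_pdivlMr// mul1r; apply: G_mono; exact: ltW.
exists (c * v `^ p), x1; split => //.
  by rewrite mulr_gt0 ?powR_gt0// (lt_le_trans ltr01).
move=> x l x1x /andP[l0 l1].
have li : 1 <= l^-1 by rewrite invf_ge1.
have [k /andP[k1 k2]] := geom_bracket v1 li.
have xx : 0 < x by exact: lt_le_trans x1x.
apply: (@le_trans _ _ (G (x / v ^+ k.+1))).
  apply: G_mono; rewrite mulrC ler_wpM2r ?(ltW xx)// -[l]invrK lef_pV2 ?posrE ?invr_gt0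
    ?exprn_gt0//.
  exact: ltW.
apply: le_trans (step _ x x1x) _; rewrite ler_wpM2r ?(ltW (G_gt0 _))//.
rewrite -mulrA ler_wpM2l ?(le_trans ler01)// exprS ler_wpM2l ?powR_ge0//.
rewrite -powRX ?(ltW v0)//.
have -> : l `^ (- p) = l^-1 `^ p by rewrite -powR_inv1 ?(ltW l0)// -powRrM mulN1r.
by apply: ge0_ler_powR; rewrite ?nnegrE ?exprn_ge0 ?invr_ge0 ?(ltW v0) ?(ltW l0).
Qed.

End potter.

(** * Truncated moments of weighted sums *)

Section moment.
Context {R : realType}.

(** Dyadic layer cake: for z in (2^-(k+1), 2^-k], or above 1 when k = 0, the term of index k alone
    dominates, and the last summand covers z <= 2^-K. *)
Lemma min_powR_layers (z q : R) K : 0 <= z -> 0 < q ->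
  Num.min z 1 `^ q <=
  \sum_(k < K) (2^-1 `^ q) ^+ k * (2^-1 ^+ k.+1 < z)%R%:R + (2^-1 `^ q) ^+ K.
Proof.
move=> z0 q0; elim: K => [|K IH].
  rewrite big_ord0 add0r expr0 [leRHS](_ : _ = 1 `^ q); last by rewrite powR1.
  by rewrite ge0_ler_powR ?nnegrE ?(ltW q0)// ?le_min ?z0 ?ler01// ge_min lexx orbT.
rewrite big_ord_recr /=; have [zK|zK] := boolP (2^-1 ^+ K.+1 < z).
  by rewrite mulr1 (le_trans IH)// lerDl exprn_ge0// powR_ge0.
rewrite mulr0 addr0 -[leLHS]add0r lerD//.
  by apply: sumr_ge0 => k _; rewrite mulr_ge0 ?exprn_ge0 ?powR_ge0.
rewrite -powRX ?invr_ge0// ge0_ler_powR ?nnegrE ?(ltW q0) ?exprn_ge0 ?invr_ge0 ?le_min ?z0 ?ler01//.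
by rewrite ge_min leNgt zK.
Qed.

Lemma sum_geom_le (x : R) K : 0 <= x < 1 -> \sum_(k < K) x ^+ k <= (1 - x)^-1.
Proof.
move=> /andP[x0 x1]; rewrite -[leRHS]mul1r ler_pdivlMr ?subr_gt0// mulrC.
by rewrite -opprB mulNr -subrX1 opprB gerBl exprn_ge0.
Qed.

(* Jensen's inequality for the power function, in perspective form so that the
   weights need not sum to 1. *)
Lemma perspective_powRD (q b B y Y : R) : 1 <= q -> 0 < b -> 0 < B ->
  0 <= y -> 0 <= Y ->
  (b + B) * ((y + Y) / (b + B)) `^ q <= b * (y / b) `^ q + B * (Y / B) `^ q.
Proof.
move=> q1 b0 B0 y0 Y0; have S0 : 0 < b + B by rewrite addr_gt0.
have t0 : 0 <= b / (b + B) by rewrite divr_ge0 ?ltW.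
have t1 : b / (b + B) <= 1 by rewrite ler_pdivrMr// mul1r lerDl ltW.
have := convex_powR q1 (Itv01 t0 t1) (x := y / b) (y := Y / B).
rewrite !inE /= !in_itv /= !andbT !divr_ge0 ?(ltW b0) ?(ltW B0)// => /(_ isT isT).
rewrite convRE [X in X `^ _ <= _]convRE /= /unstable.onem.
have -> : 1 - b / (b + B) = B / (b + B) by field; rewrite gt_eqF.
rewrite mulrACA [X in (X + _) `^ q](_ : _ = y / (b + B)); last first.
  by field; rewrite !gt_eqF.
rewrite [X in (_ + X) `^ q](_ : _ = Y / (b + B)); last by field; rewrite !gt_eqF.
rewrite -mulrDl => H; rewrite mulrC -ler_pdivlMr//; apply: le_trans H _.
by rewrite mulrDl !(mulrAC _ _ (b + B)^-1).
Qed.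

Lemma perspective_powR_sum (q : R) (r : seq nat) (b y : nat -> R) : 1 <= q ->
  (forall i, 0 < b i) -> (forall i, 0 <= y i) ->
  (\sum_(i <- r) b i) * ((\sum_(i <- r) y i) / \sum_(i <- r) b i) `^ q <=
  \sum_(i <- r) b i * (y i / b i) `^ q.
Proof.
move=> q1 b0 y0; elim: r => [|i r IH]; first by rewrite !big_nil mul0r.
case: r IH => [|j r] IH; first by rewrite !big_seq1.
rewrite !(big_cons _ _ i (j :: r)).
apply: le_trans (perspective_powRD _ _ _ _ _) _ => //.
- by rewrite big_cons ltr_pwDl// sumr_ge0// => k _; exact: ltW.
- by rewrite sumr_ge0.
- by rewrite lerD2l.
Qed.

(** Closed form, for p < q, of the sum over k >= 0 of 2^(-q k) 2^(p (k+1)): the weight of the k-th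
    dyadic layer times the tail bound l^(-p) at l = 2^-(k+1). *)
Definition layer_sum (p q : R) : R := 2 `^ p / (1 - 2^-1 `^ q * 2 `^ p).

Lemma layer_sum_ge0 p q : p <= q -> 0 <= layer_sum p q.
Proof.
move=> pq; rewrite divr_ge0 ?powR_ge0// subr_ge0 -powR_inv1// -powRrM mulN1r.
rewrite -powRD ?pnatr_eq0 ?implybT// -[leRHS](powRr0 (2 : R)) ler_powR ?ler1n//.
by rewrite addrC subr_le0.
Qed.

Context d (T : measurableType d) (P : probability T R).

Lemma measurable_superlevel (Z : T -> R) l : measurable_fun setT Z ->
  measurable [set w | l < Z w].
Proof.
move=> mZ; rewrite [X in measurable X](_ : _ = setT `&` Z @^-1` `]l, +oo[%classic).
  exact: mZ.
by rewrite setTI; apply/seteqP; split=> w /=; rewrite in_itv/= andbT.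
Qed.

(** Since [p < q], the bounds on the dyadic layers of the moment decrease geometrically with ratio
    2^(p-q); the truncation at 1 leaves only levels l <= 1, where the tail bound is available. *)
Lemma expectation_min_powR (Z : T -> R) (p q M : R) : measurable_fun setT Z ->
  (forall w, 0 <= Z w) -> 0 <= p < q -> 0 <= M ->
  (forall l, 0 < l <= 1 -> (P [set w | (l < Z w)%R] <= (M * l `^ (- p))%:E)%E) ->
  (\int[P]_w (Num.min (Z w) 1 `^ q)%:E <=
    (layer_sum p q * M)%:E)%E.
Proof.
move=> mZ Z0 /andP[p0 pq] M0 HP; have q0 : 0 < q by exact: le_lt_trans pq.
rewrite /layer_sum; set c := 2^-1 `^ q; set A := 2 `^ p.
have c0 : 0 < c by rewrite powR_gt0// invr_gt0.
have A0 : 0 < A by rewrite powR_gt0.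
have c1 : c < 1.
  rewrite -(powRr0 (2^-1 : R)) /c /powR gt_eqF ?invr_gt0// ltr_expR.
  by rewrite mul0r pmulr_rlt0// ln_lt0// invr_gt0 ltr0n/= invf_lt1// ltr1n.
have cA : c * A < 1.
  rewrite /c -powR_inv1// -powRrM mulN1r powRN mulrC ltr_pdivrMr ?powR_gt0//.
  by rewrite mul1r /A /powR gt_eqF// ltr_expR ltr_pM2r// ln_gt0// ltr1n.
have mE l : measurable [set w | l < Z w].
  exact: measurable_superlevel.
apply/lee_addgt0Pr => e e0.
have [K cK] : exists K : nat, c ^+ K < e.
  have := @cvg_expr R c; rewrite gtr0_norm// => /(_ c1) /cvgr_lt /(_ _ e0).
  by case=> K _ /(_ K (leqnn K)) ?; exists K.
pose f k w : \bar R := ((c ^+ k) * (2^-1 ^+ k.+1 < Z w)%R%:R)%:E.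
have fE k : f k = (fun w => (c ^+ k)%:E * (\1_[set w | (2^-1 ^+ k.+1 < Z w)%R] w)%:E)%E.
  by apply/funext => w; rewrite /f indicE -EFinM; congr (_ * _)%:E; rewrite mem_setE.
have mf k : measurable_fun setT (f k).
  rewrite fE; apply: measurable_funeM; apply/measurable_EFinP.
  exact: measurable_indic.
have f0 k w : (0 <= f k w)%E.
  by rewrite lee_fin mulr_ge0 ?exprn_ge0 ?(ltW c0).
apply: (@le_trans _ _ (\int[P]_w (\sum_(k < K) f k w + (c ^+ K)%:E))%E).
  apply: ge0_le_integral => //.
  - by move=> w _; rewrite lee_fin powR_ge0.
  - apply/measurable_EFinP; apply: (measurableT_comp (measurable_powR q)).
    exact: measurable_minr.
  - by apply: emeasurable_funD => //; apply: emeasurable_sum => k.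
  - by move=> w _; rewrite sumEFin -EFinD lee_fin min_powR_layers.
rewrite ge0_integralD//; last 3 first.
- by move=> w _; rewrite sume_ge0.
- by apply: emeasurable_sum => k.
- by move=> w _; rewrite lee_fin exprn_ge0// ltW.
rewrite integral_cst// [X in (_ * X)%E]probability_setT mule1; apply: leeD;
  last by rewrite lee_fin ltW.
rewrite ge0_integral_sum//.
apply: (@le_trans _ _ (\sum_(k < K) (c ^+ k * (M * A ^+ k.+1))%:E)%E).
  apply: lee_sum => k _; rewrite fE ge0_integralZl_EFin ?exprn_ge0 ?(ltW c0)//; last first.
    by apply/measurable_EFinP; exact: measurable_indic.
  rewrite integral_indic// setIT EFinM lee_wpmul2l ?lee_fin ?exprn_ge0 ?(ltW c0)//.
  apply: le_trans (HP _ _) _; first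
    by rewrite exprn_gt0 ?invr_gt0//= exprn_ile1 ?invr_ge0// invf_le1 ?ler1n.
  rewrite lee_fin ler_wpM2l// powRX ?invr_ge0// /A -powR_inv1// -powRrM.
  by rewrite mulN1r opprK.
rewrite sumEFin lee_fin.
have -> : \sum_(k < K) c ^+ k * (M * A ^+ k.+1) = A * M * \sum_(k < K) (c * A) ^+ k.
  by rewrite mulr_sumr; apply: eq_bigr => k _; rewrite exprMn exprS; ring.
rewrite [leRHS]mulrAC ler_wpM2l ?mulr_ge0 ?(ltW A0)//.
by rewrite sum_geom_le// cA andbT mulr_ge0 ?ltW.
Qed.

(** Only marginal tails enter: Markov's inequality of order [q] for the sum truncated termwise at 1,
    then Jensen with weights b_i = a_i^(1/q). These weights balance the terms: b_i (Y_i / b_i)^q has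
    integral at most C M a_i b_i^(1-q) = C M b_i, so the terms add up to C M S, and the prefactor
    S^(q-1) completes S^q. *)
Lemma sum_tail_moment (Z : nat -> T -> R) (a : nat -> R) (r : seq nat) (p q M : R) :
  (forall i, measurable_fun setT (Z i)) -> (forall i w, 0 <= Z i w) ->
  0 <= p < q -> 1 <= q -> 0 <= M -> (forall i, 0 < a i) ->
  (forall i l, 0 < l <= 1 -> (P [set w | (l < Z i w)%R] <= (M * a i * l `^ (- p))%:E)%E) ->
  (P [set w | (1 < \sum_(i <- r) Z i w)%R] <=
    (layer_sum p q * M * (\sum_(i <- r) a i `^ q^-1) `^ q)%:E)%E.
Proof.
move=> mZ Z0 pq q1 M0 a0 HP; set C := layer_sum p q.
have C0 : 0 <= C by apply: layer_sum_ge0; case/andP: pq => _ /ltW.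
have q0 : 0 < q by exact: lt_le_trans q1.
pose b i := a i `^ q^-1; have b0 i : 0 < b i by rewrite powR_gt0.
case: r => [|i0 r].
  rewrite [X in P X](_ : _ = set0) ?measure0; last first.
    by apply/seteqP; split => w //=; rewrite big_nil ltr10.
  by rewrite lee_fin mulr_ge0 ?powR_ge0// mulr_ge0.
set S := \sum_(i <- i0 :: r) _.
have S0 : 0 < S.
  rewrite /S big_cons; apply: ltr_pwDl; first exact: b0.
  by apply: sumr_ge0 => i _; exact/ltW/b0.
pose Y i w := Num.min (Z i w) 1.
have Y0 i w : 0 <= Y i w by rewrite le_min Z0 ler01.
have mY i : measurable_fun setT (Y i) by exact: measurable_minr.
have mE : measurable [set w | 1 < \sum_(i <- i0 :: r) Z i w].
  apply: measurable_superlevel; exact: measurable_sum.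
pose g i w : \bar R := (b i * (Y i w / b i) `^ q)%:E.
have gE i : g i = fun w => ((b i * (b i)^-1 `^ q)%:E * (Y i w `^ q)%:E)%E.
  by apply/funext => w; rewrite /g powRM ?invr_ge0 ?(ltW (b0 i))// -EFinM; congr EFin; ring.
have mYq i : measurable_fun setT (fun w => (Y i w `^ q)%:E).
  by apply/measurable_EFinP; apply: (measurableT_comp (measurable_powR q)).
have mg i : measurable_fun setT (g i) by rewrite gE; exact: measurable_funeM.
have g0 i w : (0 <= g i w)%E by rewrite lee_fin mulr_ge0 ?powR_ge0// ltW.
have gle i : (\int[P]_w g i w <= (C * M * b i)%:E)%E.
  rewrite gE ge0_integralZl_EFin//; last 2 first.
  - by move=> w _; rewrite lee_fin powR_ge0.
  - by rewrite mulr_ge0 ?powR_ge0// ltW.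
  have := @expectation_min_powR (Z i) p q (M * a i) (mZ i) (Z0 i) pq.
  rewrite mulr_ge0 ?(ltW (a0 i))// => /(_ isT (HP i)) H.
  apply: le_trans (lee_wpmul2l _ H) _.
    by rewrite lee_fin mulr_ge0 ?powR_ge0// ltW.
  have aE : a i = b i `^ q by rewrite /b -powRrM mulVf ?gt_eqF// powRr1// ltW.
  rewrite -EFinM lee_fin {}aE -/C -powR_inv1 ?(ltW (b0 i))// -powRrM mulN1r powRN.
  have := powR_gt0 q (b0 i); move: (b i `^ q) => t t0.
  by rewrite mulrACA -mulrA [leLHS](_ : _ = C * M * b i)//; field; rewrite gt_eqF.
have H : (P [set w | (1 < \sum_(i <- i0 :: r) Z i w)%R] <=
    \int[P]_w ((S `^ q / S)%:E * \sum_(i <- i0 :: r) g i w))%E.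
  rewrite -[X in P X]setIT -integral_indic//.
  apply: ge0_le_integral => //.
  - by apply/measurable_EFinP; exact: measurable_indic.
  - by apply: measurable_funeM; exact: emeasurable_sum.
  - move=> w _; rewrite indicE; have [|_] := boolP (_ \in _); last first.
      by rewrite mule_ge0 ?sume_ge0// lee_fin divr_ge0 ?powR_ge0 ?ltW.
    rewrite inE /= => Hw; rewrite sumEFin -EFinM lee_fin.
    apply: (@le_trans _ _ (S `^ q / S * (S * ((\sum_(i <- i0 :: r) Y i w) / S) `^ q))).
      rewrite mulrA divfK ?gt_eqF// -powRM ?divr_ge0 ?(sumr_ge0 _ (fun i _ => Y0 i w)) ?(ltW S0)//.
      rewrite mulrC divfK ?gt_eqF// [leLHS](_ : _ = 1 `^ q); last by rewrite powR1.
      rewrite ge0_ler_powR ?nnegrE ?(ltW q0) ?(sumr_ge0 _ (fun i _ => Y0 i w))//.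
      (* A term that is at least 1 is truncated to 1 and alone brings the truncated sum to 1; if
         there is none, truncation changes nothing. *)
      have [[j jr Yj]|nY] := pselect (exists2 j, j \in i0 :: r & 1 <= Z j w).
        rewrite (big_rem j)//= [Y j w]min_r// lerDl sumr_ge0//.
      apply: ltW; apply: lt_le_trans Hw _; rewrite le_eqVlt; apply/orP; left.
      apply/eqP; rewrite big_seq [RHS]big_seq; apply: eq_bigr => j jr.
      by rewrite /Y min_l// ltW// ltNge; apply/negP => Zj; apply: nY; exists j.
    rewrite ler_wpM2l ?divr_ge0 ?powR_ge0 ?(ltW S0)//.
    exact: perspective_powR_sum.
apply: le_trans H _; rewrite ge0_integralZl_EFin//; last 3 first.
- by move=> w _; rewrite sume_ge0.
- exact: emeasurable_sum.
- by rewrite divr_ge0 ?powR_ge0 ?ltW.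
rewrite ge0_integral_sum//.
apply: (@le_trans _ _ ((S `^ q / S)%:E * \sum_(i <- i0 :: r) (C * M * b i)%:E)%E).
  apply: lee_wpmul2l; first by rewrite lee_fin divr_ge0 ?powR_ge0 ?ltW.
  by apply: lee_sum => i _.
rewrite sumEFin -EFinM -mulr_sumr lee_fin -/S.
rewrite [leLHS](_ : _ = C * M * S `^ q)//.
by move: (S `^ q) => t; field; rewrite gt_eqF.
Qed.

End moment.

(** * Products with an independent factor *)

Section independent_product.
Context {R : realType} d (T : measurableType d) (P : probability T R).

Lemma tailE (W : T -> R) x : measurable_fun setT W ->
  P [set w | x < W w] = (tail P W x)%:E.
Proof. by move=> mW; rewrite fineK// fin_num_measure//; exact: measurable_superlevel. Qed.

Lemma tail_ge0 (W : T -> R) x : 0 <= tail P W x.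
Proof. by rewrite fine_ge0. Qed.

Lemma tail_le1 (W : T -> R) x : measurable_fun setT W -> tail P W x <= 1.
Proof.
by move=> mW; rewrite -lee_fin -tailE// probability_le1//; exact: measurable_superlevel.
Qed.

Lemma tail_mono (W : T -> R) : measurable_fun setT W ->
  {homo tail P W : x y /~ x <= y}.
Proof.
move=> mW x y xy; rewrite -lee_fin -!tailE//; apply: le_measure; rewrite ?inE;
  try exact: measurable_superlevel.
by move=> w /=; exact: le_lt_trans.
Qed.

Lemma measurable_tail_div (W th : T -> R) y :
  measurable_fun setT W -> measurable_fun setT th -> (forall w, 0 < th w) ->
  measurable_fun setT (fun w => tail P W (y / th w)).
Proof.
move=> mW mth th0; apply: measurableT_comp.
  by apply: nonincreasing_measurable => // s t st; exact: tail_mono.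
apply: measurable_funM => //.
rewrite [X in measurable_fun _ X](_ : _ = fun w => th w `^ (-1)).
  exact: (measurableT_comp (measurable_powR (-1))).
by apply/funext => w; rewrite powR_inv1// ltW.
Qed.

Definition indep_pair (W th : T -> R) := forall E1 E2 : set R,
  measurable E1 -> measurable E2 ->
  P (W @^-1` E1 `&` th @^-1` E2) = (P (W @^-1` E1) * P (th @^-1` E2))%E.

(** By independence the law of [(th, W)] is a product on rectangles, hence everywhere; [th] comes
    first so that the integral over it is the outer one. *)
Lemma indep_mul_tail (W th : T -> R) y :
  measurable_fun setT W -> measurable_fun setT th -> indep_pair W th ->
  (forall w, 0 < th w) ->
  P [set w | y < W w * th w] = (\int[P]_w (tail P W (y / th w))%:E)%E.
Proof.
move=> mW mth Wth th0.
pose W' : {mfun T >-> R} := HB.pack W (isMeasurableFun.Build _ _ _ _ W mW).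
pose th' : {mfun T >-> R} := HB.pack th (isMeasurableFun.Build _ _ _ _ th mth).
pose f w := (th w, W w).
have mf : measurable_fun setT f by exact/measurable_fun_pairP.
pose f' : {mfun T >-> (R * R)%type} := HB.pack f (isMeasurableFun.Build _ _ _ _ f mf).
pose S := [set u : R * R | y < u.2 * u.1].
have mS : measurable S.
  by apply: measurable_superlevel; exact: measurable_funM.
have -> : P [set w | y < W w * th w] = distribution P f' S by [].
have <- := @product_measure_unique _ _ _ _ _ (distribution P th') (distribution P W')
  (distribution P f') _ S mS.
  rewrite /product_measure1 ge0_integral_distribution//; last first.
    exact: measurable_fun_xsection.
  apply: eq_integral => w _ /=; rewrite -tailE// /distribution/= /pushforward; congr (P _).
  by apply/seteqP; split=> v /=; rewrite /xsection/= inE /= ltr_pdivrMr.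
by move=> A B mA mB; rewrite /distribution/= /pushforward muleC -Wth// setIC.
Qed.

(* The classical lemma of Breiman, immediate here since the factor is at most 1. *)
Lemma breiman_le1 (W th : T -> R) (alpha : R) :
  measurable_fun setT W -> measurable_fun setT th -> indep_pair W th ->
  0 <= alpha ->
  (forall w, 0 < th w <= 1) -> (forall y, 0 < tail P W y) ->
  regularly_varying alpha (tail P W) ->
  fine (P [set w | x < W w * th w]) / tail P W x @[x --> +oo] -->
    fine (\int[P]_w (th w `^ alpha)%:E).
Proof.
move=> mW mth Wth al0 th01 G0 rv; set G := tail P W.
have th0 w : 0 < th w by case/andP: (th01 w).
have Gle x w : 0 <= x -> G (x / th w) <= G x.
  by move=> x0; apply: tail_mono => //; rewrite ler_peMr// invf_ge1//; case/andP: (th01 w).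
apply/cvg_pinftyP => u uoo.
have mthal : measurable_fun setT (fun w => (th w `^ alpha)%:E).
  by apply/measurable_EFinP; apply: (measurableT_comp (measurable_powR alpha)).
have Ith : (\int[P]_w (th w `^ alpha)%:E)%E \is a fin_num.
  rewrite ge0_fin_numE; last by apply: integral_ge0 => w _; rewrite lee_fin powR_ge0.
  apply: (@le_lt_trans _ _ (\int[P]_w (cst 1%E) w)%E); last first.
    by rewrite integral_cst// mul1e -ge0_fin_numE// fin_num_measure.
  apply: ge0_le_integral => //; first by move=> w _; rewrite lee_fin powR_ge0.
  move=> w _; rewrite lee_fin -[leRHS](powRr0 (th w)).
  by apply: ger_powR.
(* Clipping at 0 makes [G (v n / th w) <= G (v n)] hold for every [n], so that the constant 1
   dominates the whole sequence; eventually [v n = u n]. *)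
pose v n := Num.max (u n) 0.
pose f n w := (G (v n / th w) / G (v n))%:E.
suff : (\int[P]_w f n w)%E @[n --> \oo] --> (\int[P]_w (th w `^ alpha)%:E)%E.
  rewrite -{1}(fineK Ith) => /fine_cvg; apply: cvg_trans.
  apply: near_eq_cvg; near=> n.
  have vE : v n = u n by apply/max_idPl; near: n; exact: (cvgryPge _).1.
  rewrite /= indep_mul_tail// /f vE.
  under eq_integral do rewrite mulrC EFinM.
  rewrite ge0_integralZl_EFin//.
  - rewrite mulrC fineM// ge0_fin_numE; last first.
      by apply: integral_ge0 => w _; rewrite lee_fin tail_ge0.
    apply: (@le_lt_trans _ _ (\int[P]_w (cst 1%E) w)%E); last first.
      by rewrite integral_cst// mul1e -ge0_fin_numE// fin_num_measure.
    apply: ge0_le_integral => //.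
    - by move=> w _; rewrite lee_fin tail_ge0.
    - by apply/measurable_EFinP; exact: measurable_tail_div.
    - by move=> w _; rewrite lee_fin tail_le1.
  - by move=> w _; rewrite lee_fin tail_ge0.
  - by apply/measurable_EFinP; exact: measurable_tail_div.
  - by rewrite invr_ge0 ltW.
have voo : v n @[n --> \oo] --> +oo.
  apply/cvgryPge => M; near=> n; rewrite le_max; apply/orP; left.
  by near: n; exact: (cvgryPge _).1.
have mf n : measurable_fun setT (f n).
  by apply/measurable_EFinP; apply: measurable_funM => //; exact: measurable_tail_div.
apply: (@dominated_cvg _ _ _ P setT measurableT f (fun w => (th w `^ alpha)%:E) (cst 1%E)) => //.
- move=> w _; apply/fine_cvgP; split; first by exists 0%N.
  have := rv (th w)^-1; rewrite invr_gt0 => /(_ (th0 w)) /cvg_pinftyP/(_ v voo).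
  have -> : (th w)^-1 `^ (- alpha) = th w `^ alpha.
    by rewrite -powR_inv1 ?(ltW (th0 w))// -powRrM mulN1r opprK.
  by apply: cvg_trans; apply: near_eq_cvg; apply: nearW => n /=; rewrite [(th w)^-1 * _]mulrC.
- exact: finite_measure_integrable_cst.
- move=> n w _; rewrite /f gee0_abs ?lee_fin ?divr_ge0 ?tail_ge0//.
  by rewrite ler_pdivrMr// mul1r Gle// le_max lexx orbT.
Unshelve. all: end_near.
Qed.
End independent_product.

Section weighted_sums.
Context {R : realType} d (T : measurableType d) (P : probability T R).
Variables (th : nat -> T -> R) (G : R -> R) (q1 p q x0 Cu Cl : R).
Hypothesis mth : forall i, measurable_fun setT (th i).
Hypothesis th01 : forall i w, 0 < th i w <= 1.
Hypothesis G_gt0 : forall x, 0 < G x.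
Hypothesis pq : 0 <= p < q.
Hypothesis q1_ge0 : 0 <= q1.
Hypothesis q_ge1 : 1 <= q.
Hypothesis x0_gt0 : 0 < x0.
Hypothesis Cu_ge0 : 0 <= Cu.
Hypothesis Cl_ge0 : 0 <= Cl.
Hypothesis GCu : forall x t, x0 <= x -> 0 < t <= 1 -> G (x / t) <= Cu * t `^ q1 * G x.
Hypothesis GCl : forall x l, x0 <= x -> 0 < l <= 1 -> G (l * x) <= Cl * l `^ (- p) * G x.

Definition moment i : R := fine (\int[P]_w (th i w `^ q1)%:E).

Let th0 i w : 0 < th i w. Proof. by case/andP: (th01 i w). Qed.

Let mthq i : measurable_fun setT (fun w => (th i w `^ q1)%:E).
Proof. by apply/measurable_EFinP; apply: (measurableT_comp (measurable_powR q1)). Qed.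

Lemma momentE i : (\int[P]_w (th i w `^ q1)%:E)%E = (moment i)%:E.
Proof.
rewrite fineK// ge0_fin_numE; last by apply: integral_ge0 => w _; rewrite lee_fin powR_ge0.
apply: (@le_lt_trans _ _ (\int[P]_w (cst 1%E) w)%E); last first.
  by rewrite integral_cst// mul1e -ge0_fin_numE// fin_num_measure.
apply: ge0_le_integral => //; first by move=> w _; rewrite lee_fin powR_ge0.
by move=> w _; rewrite lee_fin -[leRHS](powRr0 (th i w)); exact: ger_powR.
Qed.

(** A zero integral of a nowhere vanishing function would make the whole space null. Positivity
    matters because powers of the moments serve as Jensen weights, by which one divides. *)
Lemma moment_gt0 i : 0 < moment i.
Proof.
rewrite -lte_fin -momentE lt_def integral_ge0 ?andbT; last first.
  by move=> w _; rewrite lee_fin powR_ge0.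
apply/negP => /eqP I0.
have /(ae_eq_integral_abs P measurableT (mthq i)) [N [mN N0 sN]] :
    (\int[P]_w `|(th i w `^ q1)%:E| = 0)%E.
  by rewrite -[RHS]I0; apply: eq_integral => w _; rewrite gee0_abs// lee_fin powR_ge0.
have NT : N = setT.
  apply/seteqP; split => // w _; apply: sN => /= /(_ Logic.I) /eqP.
  by rewrite eqe gt_eqF// powR_gt0.
by have /eqP := probability_setT P; rewrite -NT N0 eqe eq_sym oner_eq0.
Qed.

(** Conditionally on [th i], the lower Potter bound is applied at [x / th i w], which is still at
    least [x0] because the factor is at most 1, and then the upper one at [x]. The result has the
    shape of the tail hypothesis in [sum_tail_moment], with a_i the moment of [th i]. *)
Lemma tail_mul_le (U : T -> R) i B x l :
  measurable_fun setT U -> indep_pair P U (th i) -> 0 <= B ->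
  (forall y, 0 < y -> tail P U y <= B * G y) -> x0 <= x -> 0 < l <= 1 ->
  (P [set w | (l * x < U w * th i w)%R] <=
   (B * Cl * Cu * G x * moment i * l `^ (- p))%:E)%E.
Proof.
move=> mU iU B0 UB xx0 /[dup] l01 /andP[l0 l1]; rewrite indep_mul_tail//.
have x_gt0 : 0 < x by exact: lt_le_trans xx0.
apply: (@le_trans _ _ (\int[P]_w
    ((B * Cl * Cu * G x * l `^ (- p))%:E * (th i w `^ q1)%:E))%E).
  apply: ge0_le_integral => //.
  - by move=> w _; rewrite lee_fin tail_ge0.
  - by apply/measurable_EFinP; exact: measurable_tail_div.
  - exact: measurable_funeM.
  - move=> w _; rewrite -EFinM lee_fin.
    apply: le_trans (UB _ _) _; first by rewrite divr_gt0 ?mulr_gt0.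
    rewrite -!mulrA ler_wpM2l//.
    have xth : x0 <= x / th i w.
      by rewrite (le_trans xx0)// ler_peMr ?(ltW x_gt0)// invf_ge1//; case/andP: (th01 i w).
    apply: le_trans (GCl xth l01) _; rewrite -mulrA ler_wpM2l//.
    rewrite [leRHS](_ : _ = l `^ (- p) * (Cu * th i w `^ q1 * G x)); last by ring.
    by rewrite ler_wpM2l ?powR_ge0// GCu.
rewrite ge0_integralZl_EFin//; last 2 first.
- by move=> w _; rewrite lee_fin powR_ge0.
- by rewrite !mulr_ge0 ?powR_ge0 ?(ltW (G_gt0 _)).
by rewrite momentE -EFinM mulrAC.
Qed.

Lemma tail_sum_le (U : nat -> T -> R) (r : seq nat) B x :
  (forall i, measurable_fun setT (U i)) -> (forall i w, 0 <= U i w) ->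
  (forall i, indep_pair P (U i) (th i)) -> 0 <= B ->
  (forall i y, 0 < y -> tail P (U i) y <= B * G y) -> x0 <= x ->
  (P [set w | (x < \sum_(i <- r) U i w * th i w)%R] <=
   (layer_sum p q * (B * Cl * Cu) * G x *
    (\sum_(i <- r) moment i `^ q^-1) `^ q)%:E)%E.
Proof.
move=> mU U0 iU B0 UB xx0; have x_gt0 : 0 < x by exact: lt_le_trans xx0.
have := @sum_tail_moment _ _ _ P (fun i w => U i w * th i w / x) moment r p q
  (B * Cl * Cu * G x).
rewrite -[X in _ -> (_ <= X)%E]/(_%:E) -![_ * G x]mulrA !mulrA => H.
apply: le_trans (H _ _ _ _ _ _ _) => //.
- rewrite le_eqVlt; apply/orP; left; apply/eqP; congr (P _).
  by apply/seteqP; split => w /=; rewrite -mulr_suml ltr_pdivlMr// mul1r.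
- by move=> i; apply: measurable_funM => //; exact: measurable_funM.
- by move=> i w; rewrite divr_ge0 ?(ltW x_gt0)// mulr_ge0// ltW.
- by rewrite !mulr_ge0 ?(ltW (G_gt0 _)).
- exact: moment_gt0.
- move=> i l l01; have := tail_mul_le (mU i) (iU i) B0 (UB i) xx0 l01.
  apply: le_trans; rewrite le_eqVlt; apply/orP; left; apply/eqP; congr (P _).
  by apply/seteqP; split => w /=; rewrite ltr_pdivlMr.
Qed.

(** The terms are nonnegative, so the events increase with N and continuity from below carries the
    bound to their union. That union is the event that the infinite sum exceeds [x], expressed
    without extended reals. *)
Lemma tail_series_le (U : nat -> T -> R) B x n S :
  (forall i, measurable_fun setT (U i)) -> (forall i w, 0 <= U i w) ->
  (forall i, indep_pair P (U i) (th i)) -> 0 <= B ->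
  (forall i y, 0 < y -> tail P (U i) y <= B * G y) -> x0 <= x ->
  (forall N, \sum_(n <= i < N) moment i `^ q^-1 <= S) ->
  (P (\bigcup_N [set w | (x < \sum_(n <= i < N) U i w * th i w)%R]) <=
   (layer_sum p q * (B * Cl * Cu) * G x * S `^ q)%:E)%E.
Proof.
move=> mU U0 iU B0 UB xx0 HS.
have mF N : measurable [set w | x < \sum_(n <= i < N) U i w * th i w].
  by apply: measurable_superlevel; apply: measurable_sum => i; exact: measurable_funM.
have S0 : 0 <= S by have := HS 0%N; rewrite big_geq.
have C0 : 0 <= layer_sum p q by apply: layer_sum_ge0; case/andP: pq => _ /ltW.
have ndF : nondecreasing_seq (fun N => [set w | x < \sum_(n <= i < N) U i w * th i w]).
  apply/nondecreasing_seqP => N; apply/subsetPset => w /= h; apply: lt_le_trans h _.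
  have [nN|Nn] := leqP n N.
    by rewrite big_nat_recr//= lerDl mulr_ge0// ltW.
  by rewrite !big_geq// ltnW.
have cF := @nondecreasing_cvg_mu _ _ _ P _ mF (bigcup_measurable (fun k _ => mF k)) ndF.
rewrite -(cvg_lim _ cF)//; apply: lime_le; first by apply/cvg_ex; eexists; exact: cF.
apply: nearW => N /=; rewrite /index_iota; apply: le_trans (tail_sum_le _ mU U0 iU B0 UB xx0) _.
have K0 := mulr_ge0 (mulr_ge0 C0 (mulr_ge0 (mulr_ge0 B0 Cl_ge0) Cu_ge0)) (ltW (G_gt0 x)).
rewrite lee_fin ler_wpM2l//.
rewrite ge0_ler_powR ?nnegrE ?(le_trans ler01 q_ge1)//; last exact: HS.
by apply: sumr_ge0 => i _; exact: powR_ge0.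
Qed.

End weighted_sums.

(** * The principle of a single big jump *)

Section measure_bounds.
Context {R : realType} d (T : measurableType d) (P : {measure set T -> \bar R}).

Lemma measure_sub_seq (I : eqType) (s : seq I) (F : I -> set T) (A : set T) :
  measurable A -> (forall i, measurable (F i)) ->
  (forall w, A w -> exists2 i, i \in s & F i w) ->
  (P A <= \sum_(i <- s) P (F i))%E.
Proof.
move=> mA mF; elim: s A mA => [|i s IH] A mA sA.
  rewrite big_nil [X in P X](_ : _ = set0) ?measure0//.
  by apply/seteqP; split => // w /sA[].
rewrite big_cons (measureDI _ mA (mF i)) addeC.
apply: leeD; first by rewrite le_measure ?inE//; exact: measurableI.
apply: IH => [|w [/sA[j]]]; first exact: measurableD.
by rewrite inE => /predU1P[->//|js Fj _]; exists j.
Qed.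

(** Induction: adjoining [A n] loses only its overlap with the earlier sets, at most the sum of the
    new pair terms. The correction stands on the right to avoid subtraction of extended reals. *)
Lemma measure_bonferroni (A : nat -> set T) n : (forall i, measurable (A i)) ->
  (\sum_(i < n) P (A i) <= P (\bigcup_(i < n) A i) +
    \sum_(i < n) \sum_(j < i) P (A i `&` A j))%E.
Proof.
move=> mA; elim: n => [|n IH]; first by rewrite !big_ord0 adde0.
set U := \bigcup_(i < n) A i.
have mU : measurable U by exact: bigcup_measurable.
have UE : \bigcup_(i < n.+1) A i = U `|` (A n `\` U).
  apply/seteqP; split => w.
    move=> [i /= + Ai]; rewrite ltnS leq_eqVlt => /predU1P[iE|ni].
      have [Uw|nUw] := pselect (U w); [by left|right; split => //].
      by rewrite -iE.
    by left; exists i.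
  case=> [[i /= ni Ai]|[An _]]; first by exists i => //=; exact: ltnW.
  by exists n => /=.
rewrite UE measureU//; last 2 first.
- exact: measurableD.
- by rewrite setDE setIA [U `&` _]setIC -setIA setICr setI0.
rewrite !big_ord_recr /= addeACA; apply: leeD => //.
rewrite (measureDI _ (mA n) mU) leeD2l//.
rewrite -(big_mkord xpredT (fun j => P (A n `&` A j))).
apply: measure_sub_seq; [exact: measurableI|by move=> i; exact: measurableI|].
by move=> w [An [j /= jn Aj]]; exists j => //; rewrite mem_index_iota.
Qed.

End measure_bounds.

Section one_big_jump.
Context {R : realType}.

(** By pigeonhole some term exceeds x/n. If no term exceeds (1-e)x, removing that one leaves more
    than e x for the others, so a second term exceeds e x/n. *)
Lemma one_big_jump (Y : nat -> R) n x e : 0 < e <= 1 -> 0 <= x ->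
  (forall i, 0 <= Y i) -> x < \sum_(i < n) Y i ->
  (exists2 i, (i < n)%N & (1 - e) * x < Y i) \/
  exists ij : nat * nat, [/\ (ij.1 < n)%N, (ij.2 < n)%N, ij.1 != ij.2,
    e / n%:R * x < Y ij.1 & e / n%:R * x < Y ij.2].
Proof.
move=> /andP[e0 e1] x0 Y0 xY.
case: n xY => [|n xY]; first by rewrite big_ord0 ltNge x0.
have [[i ni Yi]|nY] := pselect (exists2 i, (i < n.+1)%N & (1 - e) * x < Y i); [by left;
  exists i|right].
have {}nY i : (i < n.+1)%N -> Y i <= (1 - e) * x.
  by move=> ni; rewrite leNgt; apply/negP => Yi; apply: nY; exists i.
have [i Yi] : exists i : 'I_n.+1, x / n.+1%:R < Y i.
  apply: contrapT => /forallNP H; move: xY; apply/negP; rewrite -leNgt.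
  apply: (@le_trans _ _ (\sum_(i < n.+1) x / n.+1%:R)).
    by apply: ler_sum => i _; rewrite leNgt; apply/negP/H.
  by rewrite sumr_const card_ord -[leLHS]mulr_natr divfK// pnatr_eq0.
have [j ji Yj] : exists2 j : 'I_n.+1, j != i & e / n.+1%:R * x < Y j.
  apply: contrapT => H; move: xY; apply/negP; rewrite -leNgt (bigD1 i)//=.
  rewrite [leRHS](_ : _ = (1 - e) * x + e * x); last by ring.
  rewrite lerD ?nY//.
  apply: (@le_trans _ _ (\sum_(j < n.+1 | j != i) e / n.+1%:R * x)).
    by apply: ler_sum => j ji; rewrite leNgt; apply/negP => Yj; apply: H; exists j.
  apply: (@le_trans _ _ (\sum_(j < n.+1) e / n.+1%:R * x)).
    rewrite [leRHS](bigD1 i)//= lerDr mulr_ge0// divr_ge0 ?ler0n// ltW//.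
  by rewrite sumr_const card_ord -[leLHS]mulr_natr mulrAC divfK// pnatr_eq0.
exists (val i, val j) => /=; split => //; first by rewrite eq_sym.
apply: le_lt_trans Yi; rewrite mulrAC ler_wpM2r ?invr_ge0 ?ler0n//.
by rewrite ler_piMl.
Qed.

End one_big_jump.

Section asymptotics.
Context {R : realType} d (T : measurableType d) (P : probability T R).
Variables (W th : nat -> T -> R) (G : R -> R) (alpha K I : R) (S : nat -> R).
Hypothesis mW : forall i, measurable_fun setT (W i).
Hypothesis mth : forall i, measurable_fun setT (th i).
Hypothesis W_ge0 : forall i w, 0 <= W i w.
Hypothesis th01 : forall i w, 0 < th i w <= 1.
Hypothesis Wth : forall i, indep_pair P (W i) (th i).
Hypothesis tailW : forall i, tail P (W i) = G.
Hypothesis G_gt0 : forall x, 0 < G x.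
Hypothesis alpha_ge0 : 0 <= alpha.
Hypothesis rvG : regularly_varying alpha G.
Hypothesis qaiW : QAI P W.
Hypothesis cvgI : series (fun i => fine (\int[P]_w (th i w `^ alpha)%:E)) @ \oo --> I.

Let Y i w := W i w * th i w.

Let th0 i w : 0 < th i w. Proof. by case/andP: (th01 i w). Qed.

Let Y0 i w : 0 <= Y i w. Proof. by rewrite mulr_ge0// ltW. Qed.

Let YW i w : Y i w <= W i w.
Proof. by rewrite ler_piMr//; case/andP: (th01 i w). Qed.

Let mY i : measurable_fun setT (Y i). Proof. exact: measurable_funM. Qed.

Let mYgt i x : measurable [set w | x < Y i w]. Proof. exact: measurable_superlevel. Qed.

Let e i := fine (\int[P]_w (th i w `^ alpha)%:E).

Let e_ge0 i : 0 <= e i.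
Proof. by rewrite fine_ge0// integral_ge0// => w _; rewrite lee_fin powR_ge0. Qed.

Lemma cvg_pinfty_ext (f g : R -> R) (l : R) : f =1 g ->
  f x @[x --> +oo] --> l -> g x @[x --> +oo] --> l.
Proof. by move=> /funext ->. Qed.

Lemma cvgM_pinfty (f g : R -> R) (l k : R) :
  f x @[x --> +oo] --> l -> g x @[x --> +oo] --> k ->
  f x * g x @[x --> +oo] --> l * k.
Proof. exact: cvgM. Qed.

Lemma cvg_sum_pinfty (J : eqType) (s : seq J) (f : J -> R -> R) (l : J -> R) :
  {in s, forall j, f j x @[x --> +oo] --> l j} ->
  \sum_(j <- s) f j x @[x --> +oo] --> \sum_(j <- s) l j.
Proof.
elim: s => [_|j s IH fl].
  by rewrite big_nil; under eq_fun do rewrite big_nil; exact: cvg_cst.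
rewrite big_cons; under eq_fun do rewrite big_cons.
apply: cvgD; first by apply: fl; rewrite mem_head.
by apply: IH => k ks; apply: fl; rewrite in_cons ks orbT.
Qed.

Lemma cvg_pinfty_scale (f : R -> R) (l c : R) : 0 < c ->
  f x @[x --> +oo] --> l -> f (c * x) @[x --> +oo] --> l.
Proof.
move=> c0 fl; apply: (cvg_comp (fun x => c * x) f _ fl).
by apply: gt0_cvgMry => //; exact: cvg_id.
Qed.

Let cvg_term i c : 0 < c ->
  fine (P [set w | (c * x < Y i w)%R]) / G x @[x --> +oo] --> c `^ (- alpha) * e i.
Proof.
move=> c0.
have H : fine (P [set w | x < W i w * th i w]) / tail P (W i) x @[x --> +oo] --> e i.
  by apply: breiman_le1 => //; rewrite tailW.
rewrite tailW in H.
apply: (cvg_pinfty_ext _ (cvgM (rvG c0) (cvg_pinfty_scale c0 H))) => x /=.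
by rewrite mulrC mulrA divfK// gt_eqF.
Qed.

Let pair_set c ij x := [set w | c * x < W ij.1 w /\ c * x < W ij.2 w].

Let mpair c ij x : measurable (pair_set c ij x).
Proof. by apply: measurableI; exact: measurable_superlevel. Qed.

Let cvg_pair c i j : 0 < c -> i != j ->
  fine (P (pair_set c (i, j) x)) / G x @[x --> +oo] --> 0.
Proof.
move=> c0 ij; have H := cvg_pinfty_scale c0 (qaiW ij).
(* Both tails in the denominator of [QAI] equal [G], hence the factor 2; regular variation replaces
   [G (c * x)] by [G x]. *)
have : fine (P (pair_set c (i, j) x)) / G x @[x --> +oo] --> c `^ (- alpha) * (2 * 0).
  have c2 : (fun _ : R => 2 : R) x @[x --> +oo] --> (2 : R) by exact: cvg_cst.
  apply: (cvg_pinfty_ext _ (cvgM_pinfty (rvG c0) (cvgM_pinfty c2 H))) => x /=.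
  by rewrite !tailW /pair_set/=; field; rewrite !gt_eqF ?addr_gt0.
by rewrite !mulr0.
Qed.

Let fineP A : measurable A -> P A = (fine (P A))%:E.
Proof. by move=> mA; rewrite fineK// fin_num_measure. Qed.

(** Finitely many terms carry more than I - eps of the limit, and dropping the others only shrinks
    the union. As Y_i <= W_i, the pair terms of Bonferroni's inequality are joint exceedances of the
    undiscounted variables at most, which [QAI] makes negligible. *)
Lemma jump_lower_bound eps : 0 < eps ->
  \forall x \near +oo, (((I - eps) * G x)%:E <= P (\bigcup_i [set w | (x < Y i w)%R]))%E.
Proof.
move=> eps0.
have Ieps : I - eps < I by rewrite gtrBl.
have /cvgr_gt /(_ _ Ieps) [n _ /(_ n (leqnn n)) /= Hn] := cvgI.
pose A x i := [set w | 1 * x < Y i w].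
pose f x := \sum_(0 <= i < n) fine (P (A x i)) / G x -
  \sum_(0 <= i < n) \sum_(0 <= j < i) fine (P (pair_set 1 (i, j) x)) / G x.
have cf : f x @[x --> +oo] --> series e n - 0.
  apply: cvgB.
    apply: cvg_sum_pinfty => i _.
    by have := @cvg_term i 1 ltr01; rewrite powR1 mul1r.
  rewrite -[X in _ --> X](_ : \sum_(0 <= i < n) \sum_(0 <= j < i) 0 = _); last first.
    by rewrite big1// => i _; rewrite big1.
  apply: cvg_sum_pinfty => i _; apply: cvg_sum_pinfty => j; rewrite mem_index_iota => /andP[_ ji].
  by apply: cvg_pair => //; rewrite gtn_eqF.
rewrite subr0 in cf; near=> x.
have fx : I - eps < f x by near: x; exact: (cvgr_gt _ cf).
have mU : measurable (\bigcup_(i < n) A x i) by apply: bigcup_measurable => i _; exact: mYgt.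
apply: (@le_trans _ _ (P (\bigcup_(i < n) A x i))); last first.
  apply: le_measure; rewrite ?inE//; first by apply: bigcup_measurable => i _; exact: mYgt.
  by move=> w [i _]; rewrite /A /= mul1r => h; exists i.
rewrite [leRHS]fineP// lee_fin -ler_pdivlMr//.
apply: le_trans (ltW fx) _; rewrite /f -!mulr_suml.
under [X in _ - X]eq_bigr do rewrite -mulr_suml.
rewrite -mulr_suml -mulrBl ler_wpM2r ?invr_ge0 ?(ltW (G_gt0 _))//.
rewrite lerBlDr -lee_fin EFinD -fineP//.
have -> : (\sum_(0 <= i < n) fine (P (A x i)))%:E = (\sum_(i < n) P (A x i))%E.
  by rewrite -sumEFin big_mkord; apply: eq_bigr => i _; rewrite -fineP//; exact: mYgt.
have -> : (\sum_(0 <= i < n) \sum_(0 <= j < i) fine (P (pair_set 1 (i, j) x)))%:E =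
    (\sum_(i < n) \sum_(j < i) P (pair_set 1 (val i, val j) x))%E.
  rewrite -sumEFin big_mkord; apply: eq_bigr => i _.
  by rewrite -sumEFin big_mkord; apply: eq_bigr => j _; rewrite -fineP.
apply: le_trans (@measure_bonferroni _ _ _ P (A x) n (fun i => mYgt i _)) _.
rewrite leeD2l//; apply: lee_sum => i _; apply: lee_sum => j _.
apply: le_measure; rewrite ?inE//; first by apply: measurableI; exact: mYgt.
by move=> w [/= h1 h2]; split; [exact: lt_le_trans (YW _ _)|exact: lt_le_trans (YW _ _)].
Unshelve. all: end_near.
Qed.

(** The level is divided into c x for the terms from [n] on and (1-c) x for the first [n], to which
    [one_big_jump] is applied with fraction [c] again. This leaves single jumps over (1-c)^2 x,
    pairs over c(1-c)x/n, and the remainder. Relative to [G x], the pairs vanish, and the limits of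
    the bounds for the other two are below I + eps/2 and eps/2. *)
Lemma jump_upper_bound (x0 : R) : (forall x n, x0 <= x ->
    (P (\bigcup_N [set w | (x < \sum_(n <= i < N) Y i w)%R]) <= (K * G x * S n)%:E)%E) ->
  0 <= K -> S @ \oo --> 0 -> forall eps, 0 < eps ->
  \forall x \near +oo, (P (\bigcup_N [set w | (x < \sum_(0 <= i < N) Y i w)%R])
    <= ((I + eps) * G x)%:E)%E.
Proof.
move=> HS K0 S0 eps eps0.
have [c [c0 c1 cI]] : exists c, [/\ 0 < c,
  c < 1 & ((1 - c) * (1 - c)) `^ (- alpha) * I < I + eps / 2].
  have h1 : (1 - x) * (1 - x) @[x --> (0 : R)^'+] --> (1 : R).
    have : (1 - x) @[x --> (0 : R)^'+] --> (1 : R).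
      rewrite -{2}(subr0 (1 : R)); apply: cvgB; first exact: cvg_cst.
      by apply: cvg_at_right_filter; exact: cvg_id.
    move=> h; have : (1 - x) * (1 - x) @[x --> (0 : R)^'+] --> (1 : R) * 1 by exact: cvgM.
    by rewrite mulr1.
  have h2 : ((1 - x) * (1 - x)) `^ (- alpha) * I @[x --> (0 : R)^'+] --> 1 `^ (- alpha) * I.
    apply: cvgM; last exact: cvg_cst.
    apply: (@continuous_cvg _ _ _ _ _ _ (fun u => u `^ (- alpha))) => //.
    apply: differentiable_continuous; apply/derivable1_diffP.
    by apply: derivable_powR; rewrite in_itv/= ltr01.
  rewrite powR1 mul1r in h2.
  have Ieps : I < I + eps / 2 by rewrite ltrDl divr_gt0.
  have h3 : \forall x \near (0 : R)^'+, ((1 - x) * (1 - x)) `^ (- alpha) * I < I + eps / 2.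
    exact: (cvgr_lt _ h2).
  have h4 : \forall x \near (0 : R)^'+, 0 < x < 1.
    by near=> x; apply/andP; split; near: x; [exact: nbhs_right_gt|exact: nbhs_right_lt].
  by have [x [? /andP[? ?]]] := filter_ex (filterI h3 h4); exists x.
(* [n] is chosen after [c], because comparing the remainder at level c x costs a factor c^(-alpha).
   It is taken positive so that the pair level with factor [c / n%:R] is positive. *)
have [n [n0 Hn]] : exists n, (0 < n)%N /\ K * c `^ (- alpha) * S n < eps / 2.
  have h : K * c `^ (- alpha) * S k @[k --> \oo] --> K * c `^ (- alpha) * 0.
    by apply: cvgM => //; exact: cvg_cst.
  have eps2 : K * c `^ (- alpha) * 0 < eps / 2 by rewrite mulr0 divr_gt0.
  have /cvgr_lt /(_ _ eps2) [k _ Hk] := h.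
  by exists k.+1; split => //; apply: Hk => /=.
pose prs := [seq ij <- [seq (i, j) | i <- iota 0 n, j <- iota 0 n] | ij.1 != ij.2].
pose f x := \sum_(i <- iota 0 n) fine (P [set w | (1 - c) * (1 - c) * x < Y i w]) / G x
  + \sum_(ij <- prs) fine (P (pair_set (c / n%:R * (1 - c)) ij x)) / G x
  + K * (G (c * x) / G x) * S n.
have cf : f x @[x --> +oo] --> \sum_(i <- iota 0 n) ((1 - c) * (1 - c)) `^ (- alpha) * e i
   + \sum_(ij <- prs) 0 + K * c `^ (- alpha) * S n.
  apply: cvgD; first apply: cvgD.
  - by apply: cvg_sum_pinfty => i _; apply: cvg_term; rewrite mulr_gt0// subr_gt0.
  - apply: cvg_sum_pinfty => -[i j]; rewrite mem_filter => /andP[ij _].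
    by apply: cvg_pair => //; rewrite mulr_gt0 ?subr_gt0// divr_gt0// ltr0n.
  - by apply: cvgMr_tmp; apply: cvgMl_tmp; exact: rvG.
have leI m : series e m <= I.
  rewrite -(cvg_lim _ cvgI)//; apply: nondecreasing_cvgn_le; last by apply/cvg_ex; exists I.
  by apply/nondecreasing_seqP => k; rewrite seriesSr lerDl.
have cf' : \forall x \near +oo, f x < I + eps.
  apply: (cvgr_lt _ cf); rewrite [X in _ + X + _]big1// addr0 -mulr_sumr.
  rewrite [ltRHS](_ : _ = (I + eps / 2) + eps / 2); last by rewrite -addrA -splitr.
  rewrite ltrD//; apply: le_lt_trans cI; rewrite ler_wpM2l ?powR_ge0//.
  by have := leI n; rewrite /series/= /index_iota subn0.
near=> x.
have x_ge0 : 0 <= x by near: x; exact: nbhs_pinfty_ge.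
have x0x : x0 <= c * x.
  by rewrite mulrC -ler_pdivrMr//; near: x; exact: nbhs_pinfty_ge.
have fx : f x < I + eps by near: x.
pose E1 i := [set w | (1 - c) * (1 - c) * x < Y i w].
pose E2 ij := pair_set (c / n%:R * (1 - c)) ij x.
pose E3 := \bigcup_N [set w | c * x < \sum_(n <= i < N) Y i w].
set E := \bigcup_N _.
have msum k y m : measurable [set w | y < \sum_(k <= i < m) Y i w].
  by apply: measurable_superlevel; exact: measurable_sum.
have mE : measurable E by apply: bigcup_measurable => N _; exact: msum.
have mE3 : measurable E3 by apply: bigcup_measurable => N _; exact: msum.
have mE1 i : measurable (E1 i) by exact: mYgt.
have incl w : E w -> ~ E3 w -> (exists2 i, i \in iota 0 n & E1 i w) \/
    exists2 ij, ij \in prs & E2 ij w.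
  move=> [N _ /= xN] nE3.
  have xn : (1 - c) * x < \sum_(i < n) Y i w.
    rewrite -(big_mkord xpredT (fun i => Y i w)).
    have [nN|Nn] := leqP n N.
      rewrite (@big_cat_nat _ _ _ n)//= in xN; have le3 : \sum_(n <= i < N) Y i w <= c * x.
        by rewrite leNgt; apply/negP => h; apply: nE3; exists N.
      by rewrite mulrBl mul1r ltrBlDr; apply: lt_le_trans xN _; rewrite lerD2l.
    apply: (@le_lt_trans _ _ x); first by rewrite ler_piMl// gerBl ltW.
    apply: lt_le_trans xN _; rewrite [leRHS](@big_cat_nat _ _ _ N)//=; last exact: ltnW.
    by rewrite lerDl sumr_ge0.
  have c01 : 0 < c <= 1 by rewrite c0 ltW.
  have x1 : 0 <= (1 - c) * x by rewrite mulr_ge0// subr_ge0 ltW.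
  case: (one_big_jump c01 x1 (fun i => Y0 i w) xn) => [[i ni Yi]|[[i j] /= [ni nj ij Yi Yj]]].
    by left; exists i; [rewrite mem_iota add0n|rewrite /E1/= -mulrA].
  right; exists (i, j).
    rewrite mem_filter /= ij; apply/allpairsP; exists (i, j).
    by rewrite !mem_iota !add0n.
  by split => /=; rewrite -mulrA; [exact: lt_le_trans (YW _ _)|exact: lt_le_trans (YW _ _)].
pose C1 := \bigcup_(i in [set` iota 0 n]) E1 i.
have mC1 : measurable C1 by apply: bigcup_measurable => i _; exact: mE1.
apply: (@le_trans _ _ (\sum_(i <- iota 0 n) P (E1 i) + \sum_(ij <- prs) P (E2 ij) + P E3)%E).
  rewrite (measureDI _ mE mE3); apply: leeD; last first.
    by apply: le_measure; rewrite ?inE//; exact: measurableI.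
  have mD : measurable (E `\` E3) by exact: measurableD.
  rewrite (measureDI _ mD mC1) addeC; apply: leeD.
    apply: measure_sub_seq => //; first exact: measurableI.
    by move=> w [_ [i /= ? ?]]; exists i.
  apply: measure_sub_seq => //; [exact: measurableD|by move=> ij; exact: mpair|].
  move=> w [[Ew nE3] nC1]; have [[i ii E1i]|//] := incl _ Ew nE3.
  by exfalso; apply: nC1; exists i.
have -> : (\sum_(i <- iota 0 n) P (E1 i) + \sum_(ij <- prs) P (E2 ij) + P E3)%E =
  (\sum_(i <- iota 0 n) fine (P (E1 i)) + \sum_(ij <- prs) fine (P (E2 ij)) + fine (P E3))%:E.
  rewrite !EFinD -!sumEFin -fineP//; congr (_ + _ + _)%E.
    by apply: eq_bigr => i _; exact: fineP.
  by apply: eq_bigr => ij _; apply: fineP; exact: mpair.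
rewrite lee_fin -ler_pdivrMr//; apply: le_trans (ltW fx).
rewrite /f -!mulr_suml -[X in _ <= _ + X](_ : K * G (c * x) * S n / G x = _); last by ring.
rewrite -!mulrDl ler_wpM2r ?invr_ge0 ?(ltW (G_gt0 _))// lerD2l.
by rewrite -lee_fin -fineP//; exact: HS.
Unshelve. all: end_near.
Qed.

End asymptotics.

(** * Geometry of ruin sets *)

Section geometry.
Context {R : realType} {d : nat}.
Variable A : set 'rV[R]_d.
Hypothesis ruinA : ruin_set A.
Implicit Types (z y : 'rV[R]_d) (u x : R).

Let openA : open A. Proof. by case: ruinA. Qed.

Lemma dilateP u z : u != 0 -> dilate u A z <-> A (u^-1 *: z).
Proof.
move=> u0; split=> [[a Aa <-]|Az]; first by rewrite scalerA mulVf// scale1r.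
by exists (u^-1 *: z) => //; rewrite scalerA divff// scale1r.
Qed.

Lemma ruin_set0 : ~ A 0.
Proof. by case: ruinA => _ _ _ + A0; apply; exact: subset_closure. Qed.

Lemma ruin_set_convexC y z t : 0 <= t <= 1 -> ~ A y -> ~ A z ->
  ~ A (t *: y + (1 - t) *: z).
Proof.
move=> /andP[t0 t1] nAy nAz; case: ruinA => _ _ cA _.
have := cA y z (Itv01 t0 t1); rewrite !inE => /(_ nAy nAz).
by [].
Qed.

(** The point z/u lies on the segment from 0 to z/s, and the complement of [A] is convex and
    contains 0. *)
Lemma dilate_le s u z : 0 < s <= u -> dilate u A z -> dilate s A z.
Proof.
move=> /andP[s0 su]; have u0 : 0 < u by exact: lt_le_trans su.
rewrite !dilateP ?gt_eqF// => Au; apply: contrapT => nAs.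
have su01 : 0 <= s / u <= 1.
  by rewrite divr_ge0 ?(ltW s0) ?(ltW u0)//= ler_pdivrMr// mul1r.
apply: (ruin_set_convexC su01 nAs ruin_set0).
by rewrite scaler0 addr0 scalerA mulrAC divff ?gt_eqF// mul1r.
Qed.

Lemma ruin_set_away : exists2 delta, 0 < delta &
  forall z, A z -> exists j, delta <= `|z 0 j|.
Proof.
case: ruinA => _ _ _; rewrite /closure/= => /existsNP[B] /not_implyP[+ AB].
move=> /nbhs_ballP[e e0 eB]; exists e => // z Az; apply: contrapT => /forallNP H.
apply: AB; exists z; split => //; apply: eB; split => // i j; rewrite (ord1 i).
by rewrite /ball/= mxE sub0r normrN ltNge; apply/negP/H.
Qed.

(** Guarantees that the [sup] in [radius_on] is a true supremum and not the default value 0 of an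
    unbounded set. *)
Lemma dilate_bound z : exists M, forall u, 0 < u -> dilate u A z -> u <= M.
Proof.
have [delta delta0 H] := ruin_set_away.
exists ((\sum_j `|z 0 j|) / delta) => u u0; rewrite dilateP ?gt_eqF// => /H[j].
rewrite mxE normrM ger0_norm ?invr_ge0 ?(ltW u0)// ler_pdivlMl// => ud.
rewrite ler_pdivlMr//; apply: le_trans ud _.
by rewrite (bigD1 j)//= lerDl sumr_ge0.
Qed.

Lemma dilate_open u : 0 < u -> open (dilate u A).
Proof.
move=> u0; rewrite [X in open X](_ : _ = [set z | A (u^-1 *: z)]).
  apply: open_comp => // z _; exact: scaler_continuous.
by apply/seteqP; split => z /=; rewrite dilateP ?gt_eqF.
Qed.

(** This is where openness of [A] makes the exceedance in [lt_radius_on] strict. *)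
Lemma dilate_gt x z : 0 < x -> dilate x A z -> exists2 u, x < u & dilate u A z.
Proof.
move=> x0; rewrite dilateP ?gt_eqF// => Az.
have /(_ x^-1) /(_ A) : continuous (fun k : R => k *: z) by exact: scalel_continuous.
rewrite /nbhs/= => /(_ _); have : nbhs (x^-1 *: z) A by exact: open_nbhs_nbhs.
move=> nA /(_ nA) /nbhs_ballP[e e0 eA].
(* The first entry keeps [k] within e of [x^-1], the second keeps it positive. *)
pose k := Num.max (x^-1 - e / 2) (x^-1 / 2).
have xi0 : 0 < x^-1 by rewrite invr_gt0.
have k0 : 0 < k by rewrite lt_max divr_gt0 ?orbT.
have kx : k < x^-1 by rewrite gt_max gtrBl divr_gt0//= gtr_pMr// invf_lt1// ltr1n.
exists k^-1; first by rewrite -[x]invrK ltf_pV2 ?posrE.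
rewrite dilateP ?invr_eq0 ?gt_eqF// invrK; apply: eA.
rewrite /ball/= gtr0_norm ?subr_gt0// ltrBlDr -ltrBlDl lt_max; apply/orP; left.
by rewrite ltrD2l ltrN2 gtr_pMr// invf_lt1// ltr1n.
Qed.

Lemma radius_on_ge0 z : 0 <= radius_on A z.
Proof.
have [S0|/set0P[u Su]] := eqVneq [set u | 0 < u /\ dilate u A z] set0.
  by rewrite /radius_on S0 sup0.
apply: (@le_trans _ _ u); first by case: Su => /ltW.
apply: ub_le_sup => //.
by have [M HM] := dilate_bound z; exists M => v [v0 Av]; exact: HM.
Qed.

Lemma lt_radius_on x z : 0 < x -> x < radius_on A z <-> dilate x A z.
Proof.
move=> x0; split=> [|Az].
  have [S0|/set0P S0] := eqVneq [set u | 0 < u /\ dilate u A z] set0.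
    by rewrite /radius_on S0 sup0 ltNge (ltW x0).
  move=> /(sup_gt S0)[u /= [u0 Au] xu].
  by apply: dilate_le Au; rewrite x0 ltW.
have [u xu Au] := dilate_gt x0 Az.
apply: lt_le_trans (xu) _; apply: ub_le_sup; last by split => //; exact: lt_trans xu.
by have [M HM] := dilate_bound z; exists M => v [v0 Av]; exact: HM.
Qed.

(** The argument for Minkowski gauges: for a and b slightly above the two radii, y/a and z/b lie in
    the convex complement of [A], and (y+z)/(a+b) is their convex combination with weight
    a/(a+b). *)
Lemma radius_onD y z : radius_on A (y + z) <= radius_on A y + radius_on A z.
Proof.
rewrite leNgt; apply/negP => lt_sum.
have [e e0 He] : exists2 e, 0 < e &
    (radius_on A y + e) + (radius_on A z + e) < radius_on A (y + z).
  exists ((radius_on A (y + z) - (radius_on A y + radius_on A z)) / 4).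
    by rewrite divr_gt0// subr_gt0.
  by lra.
set a := radius_on A y + e in He; set b := radius_on A z + e in He.
have a0 : 0 < a by rewrite ltr_wpDl// radius_on_ge0.
have b0 : 0 < b by rewrite ltr_wpDl// radius_on_ge0.
have ab0 : 0 < a + b by rewrite addr_gt0.
have nAy : ~ A (a^-1 *: y).
  by rewrite -dilateP ?gt_eqF// -lt_radius_on//; apply/negP; rewrite -leNgt lerDl ltW.
have nAz : ~ A (b^-1 *: z).
  by rewrite -dilateP ?gt_eqF// -lt_radius_on//; apply/negP; rewrite -leNgt lerDl ltW.
have t01 : 0 <= a / (a + b) <= 1.
  by rewrite divr_ge0 ?(ltW a0) ?(ltW ab0)//= ler_pdivrMr// mul1r lerDl ltW.
apply: (ruin_set_convexC t01 nAy nAz).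
move: He; rewrite lt_radius_on// dilateP ?gt_eqF// scalerDr !scalerA.
rewrite [_ / a](_ : _ = (a + b)^-1); last by field; rewrite !gt_eqF.
by rewrite [_ / b](_ : _ = (a + b)^-1)//; field; rewrite !gt_eqF.
Qed.

Lemma lt_radius_onZ x t z : 0 < x -> 0 < t ->
  x < radius_on A (t *: z) <-> x < radius_on A z * t.
Proof.
move=> x0 t0; rewrite lt_radius_on// -ltr_pdivrMr// lt_radius_on ?divr_gt0//.
by rewrite !dilateP ?gt_eqF ?divr_gt0// invf_div scalerA mulrC.
Qed.

Lemma radius_onZ_le t z : 0 < t -> radius_on A (t *: z) <= radius_on A z * t.
Proof.
move=> t0; rewrite leNgt; apply/negP => lt_t.
have m0 : 0 < (radius_on A (t *: z) + radius_on A z * t) / 2.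
  rewrite divr_gt0// ltr_pwDl ?mulr_ge0 ?radius_on_ge0 ?(ltW t0)//.
  by apply: le_lt_trans lt_t; rewrite mulr_ge0 ?radius_on_ge0 ?ltW.
by have [/(_ _)+ _] := lt_radius_onZ z m0 t0; lra.
Qed.

Lemma radius_on0 : radius_on A 0 = 0.
Proof.
rewrite /radius_on [X in sup X](_ : _ = set0) ?sup0//.
apply/seteqP; split => // u [u0]; rewrite dilateP ?gt_eqF// scaler0.
exact: ruin_set0.
Qed.

Lemma radius_on_sum n (t : nat -> R) (z : nat -> 'rV[R]_d) : (forall i, 0 < t i) ->
  radius_on A (\sum_(0 <= i < n) t i *: z i) <= \sum_(0 <= i < n) radius_on A (z i) * t i.
Proof.
move=> t0; elim: n => [|n IH]; first by rewrite !big_geq// radius_on0.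
rewrite !big_nat_recr//=; apply: le_trans (radius_onD _ _) _.
by rewrite lerD// radius_onZ_le.
Qed.

Lemma dilate_increasing x y z : 0 < x -> (forall j, 0 <= z 0 j) ->
  dilate x A y -> dilate x A (y + z).
Proof.
move=> x0 z0; rewrite !dilateP ?gt_eqF// => Ay; rewrite scalerDr.
by case: ruinA => _ incA _ _; apply: incA => // j; rewrite mxE mulr_ge0// invr_ge0 ltW.
Qed.

Lemma open_lt_radius x : open [set z | x < radius_on A z].
Proof.
have [x0|x0] := ltP 0 x.
  rewrite [X in open X](_ : _ = dilate x A); first exact: dilate_open.
  by apply/seteqP; split => z /=; rewrite lt_radius_on.
rewrite le_eqVlt in x0; case/predU1P : x0 => [->|x0].
  rewrite [X in open X](_ : _ = \bigcup_(u in [set u : R | 0 < u]) dilate u A).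
    by apply: bigcup_open => u; exact: dilate_open.
  apply/seteqP; split => z /=.
    move=> z0; exists (radius_on A z / 2); first by rewrite /= divr_gt0.
    by apply/lt_radius_on; rewrite ?divr_gt0// gtr_pMr// invf_lt1// ltr1n.
  by move=> [u /= u0] /lt_radius_on-/(_ u0); exact: lt_trans.
rewrite [X in open X](_ : _ = setT); first exact: openT.
by apply/seteqP; split => z //= _; exact: lt_le_trans (radius_on_ge0 _).
Qed.

Lemma measurable_radius_on :
  measurable_fun setT (radius_on A : borelRV R d -> R).
Proof.
apply: (measurability (@RGenOInfty.G R)).
  exact: RGenOInfty.measurableE.
move=> _ [_ [x ->] <-]; rewrite setTI; apply: sub_sigma_algebra.
rewrite [X in open X](_ : _ = [set z | x < radius_on A z]); first exact: open_lt_radius.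
by apply/seteqP; split => z /=; rewrite in_itv/= andbT.
Qed.

End geometry.

Section ruin_event.
Context {R : realType} {d : nat} {dT : measure_display} {T : measurableType dT}.

Lemma measurable_coord (j : 'I_d) :
  measurable_fun setT ((fun z : 'rV[R]_d => z 0 j) : borelRV R d -> R).
Proof.
apply: (measurability (@RGenOInfty.G R)).
  exact: RGenOInfty.measurableE.
move=> _ [_ [x ->] <-]; rewrite setTI; apply: sub_sigma_algebra.
rewrite [X in open X](_ : _ = (fun z : 'rV[R]_d => z 0 j) @^-1` [set t | x < t]).
  by apply: open_comp => [z _|]; [exact: coord_continuous|exact: open_gt].
by apply/seteqP; split => z /=; rewrite in_itv/= andbT.
Qed.

(** The event is the countable union, over rational vectors v in [B], of the events that v <= [S] in
    every coordinate: openness supplies a rational point of [B] just below [S w], and monotonicity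
    of [B] gives the converse. *)
Lemma measurable_open_increasing (B : set 'rV[R]_d) (S : T -> 'rV[R]_d) :
  open B -> increasing_set B -> (forall j, measurable_fun setT (fun w => S w 0 j)) ->
  measurable [set w | B (S w)].
Proof.
move=> openB incB mS.
pose C (v : 'rV[rat]_d) : set T := if pselect (B (map_mx ratr v)) then
  \bigcap_(j in [set: 'I_d]) [set w | ratr (v 0 j) <= S w 0 j] else set0.
rewrite [X in measurable X](_ : _ = \bigcup_v C v).
  apply: countable_bigcupT_measurable => [|v]; first exact: countableP.
  rewrite /C; case: (pselect (B (map_mx ratr v))) => [?|?]; last exact: measurable0.
  apply: fin_bigcap_measurable => // j _.
  rewrite [X in measurable X](_ : _ = setT `&` (fun w => S w 0 j) @^-1` `[ratr (v 0 j),
    +oo[%classic).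
    by apply: mS.
  by rewrite setTI; apply/seteqP; split=> w /=; rewrite in_itv/= andbT.
apply/seteqP; split => w /=; last first.
  move=> [v _]; rewrite /C; case: (pselect (B (map_mx ratr v))) => // Bv H.
  rewrite (_ : S w = map_mx ratr v + (S w - map_mx ratr v)); last by rewrite addrC subrK.
  by apply: incB => // j; rewrite !mxE subr_ge0; exact: H.
move=> BS; have : nbhs (S w) B by exact: open_nbhs_nbhs.
move=> /nbhs_ballP[e e0 eB].
have H j : exists q : rat, S w 0 j - e < ratr q < S w 0 j.
  have : S w 0 j - e < S w 0 j by rewrite gtrBl.
  by move=> /rat_in_itvoo[q]; rewrite in_itv; exists q.
have [v Hv] := fin_all_exists H.
exists (\row_j v j) => //; rewrite /C;
  case: (pselect (B (map_mx ratr (\row_j v j)))) => [? j _ /=|nB].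
  by rewrite mxE; have /andP[_ /ltW] := Hv j.
apply: nB; apply: eB; split => // i j; rewrite (ord1 i) !mxE.
have /andP[h1 h2] := Hv j.
by rewrite /ball/= gtr0_norm ?subr_gt0// ltrBlDl -ltrBlDr.
Qed.

Variables (A : set 'rV[R]_d) (X : nat -> T -> 'rV[R]_d) (th : nat -> T -> R).
Hypothesis ruinA : ruin_set A.
Hypothesis X_ge0 : forall i w j, 0 <= X i w 0 j.
Hypothesis mX : forall i, measurable_fun setT (X i : T -> borelRV R d).
Hypothesis th_gt0 : forall i w, 0 < th i w.
Hypothesis mth : forall i, measurable_fun setT (th i).

Definition weighted_series (w : T) : 'rV[\bar R]_d :=
  \row_j (\sum_(0 <= i <oo) (X i w 0 j * th i w)%:E)%E.

Let S N w := \sum_(0 <= i < N) th i w *: X i w.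

Let term_ge0 i w j : 0 <= X i w 0 j * th i w.
Proof. by rewrite mulr_ge0// ltW. Qed.

Let S_coord N w j : S N w 0 j = \sum_(0 <= i < N) X i w 0 j * th i w.
Proof. by rewrite /S summxE; apply: eq_bigr => i _; rewrite mxE mulrC. Qed.

Let S_le N w j : ((S N w 0 j)%:E <= weighted_series w 0%R j)%E.
Proof.
rewrite mxE S_coord -sumEFin; apply: nneseries_lim_ge => i _ _.
by rewrite lee_fin.
Qed.

Let S_cvg w j : (S N w 0 j)%:E @[N --> \oo] --> weighted_series w 0%R j.
Proof.
rewrite mxE; under eq_fun do rewrite S_coord -sumEFin.
by apply: is_cvg_nneseries => i _ _; rewrite lee_fin.
Qed.

(** The dilate is open, so it already contains a partial sum close to the limit; conversely it is
    increasing and the remainder has nonnegative coordinates. Finiteness is a separate clause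
    because the image under [embed] has only finite points. *)
Lemma weighted_series_dilateP x w : 0 < x ->
  (embed @` dilate x A) (weighted_series w) <->
  (forall j, (weighted_series w 0%R j < +oo)%E) /\ exists N, dilate x A (S N w).
Proof.
move=> x0; split=> [[z Az zE]|[fin_w [N AS]]].
  split=> [j|]; first by rewrite -zE mxE ltry.
  have : nbhs z (dilate x A) by apply: open_nbhs_nbhs; split => //; exact: dilate_open.
  case=> Q zQ QA.
  have : \forall N \near \oo, forall j, Q 0 j (S N w 0 j).
    apply: filter_forall => j; have /fine_cvg h : (S N w 0 j)%:E @[N --> \oo] --> (z 0 j)%:E.
      by have := @S_cvg w j; rewrite -zE mxE.
    by apply: h; exact: zQ.
  case=> N _ /(_ N (leqnn N)) SQ; exists N; apply: QA => i j.
  by rewrite (ord1 i).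
pose z : 'rV[R]_d := \row_j fine (weighted_series w 0%R j).
have zE j : weighted_series w 0%R j = (z 0 j)%:E.
  rewrite [in RHS]mxE fineK// ge0_fin_numE//; apply: le_trans (S_le 0 w j).
  by rewrite S_coord big_geq.
exists z; last by apply/rowP => j; rewrite mxE zE.
rewrite -(subrK (S N w) z) addrC; apply: dilate_increasing => // j.
have -> : (z - S N w) 0 j = z 0 j - S N w 0 j.
  by rewrite [LHS]mxE; congr (_ + _); rewrite mxE.
by rewrite subr_ge0 -lee_fin -zE.
Qed.

Lemma measurable_ruin x : 0 < x ->
  measurable [set w | (embed @` dilate x A) (weighted_series w)].
Proof.
move=> x0.
rewrite [X in measurable X](_ : _ =
    (\bigcap_(j in [set: 'I_d]) [set w | (weighted_series w 0%R j < +oo)%E]) `&`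
    \bigcup_N [set w | dilate x A (S N w)]).
  apply: measurableI.
    apply: fin_bigcap_measurable => // j _; rewrite -[X in measurable X]setTI.
    apply: emeasurable_fun_infty_o => //.
    under eq_fun do rewrite mxE.
    apply: ge0_emeasurable_sum => [i w _ _|i _]; first by rewrite lee_fin.
    apply/measurable_EFinP; apply: measurable_funM => //.
    exact: (measurableT_comp (measurable_coord j) (mX i)).
  apply: bigcup_measurable => N _; apply: measurable_open_increasing.
  - exact: dilate_open.
  - by move=> y z Ay z0; exact: dilate_increasing.
  - move=> j; under eq_fun do rewrite S_coord.
    apply: measurable_sum => i; apply: measurable_funM => //.
    exact: (measurableT_comp (measurable_coord j) (mX i)).
apply/seteqP; split => w /=.
  by move=> /(weighted_series_dilateP _ x0)[h [N HN]]; split => [j _|]; [exact: h|exists N].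
by move=> [h [N _ HN]]; apply/(weighted_series_dilateP _ x0); split=> [j|]; [exact: h|exists N].
Qed.

Lemma ruin_sub_radius x w : 0 < x -> (embed @` dilate x A) (weighted_series w) ->
  exists N, x < \sum_(0 <= i < N) radius_on A (X i w) * th i w.
Proof.
move=> x0 /(weighted_series_dilateP _ x0)[_ [N AS]]; exists N.
apply: lt_le_trans (radius_on_sum _ _ _ _) => //.
by apply/lt_radius_on.
Qed.

Lemma radius_sub_ruin x w i : 0 < x -> (forall j, (weighted_series w 0%R j < +oo)%E) ->
  x < radius_on A (X i w) * th i w -> (embed @` dilate x A) (weighted_series w).
Proof.
move=> x0 fin_w /(lt_radius_onZ ruinA _ x0 (th_gt0 i w)) /(lt_radius_on ruinA _ x0) Ai.
apply/(weighted_series_dilateP _ x0); split => //; exists i.+1.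
rewrite /S big_nat_recr//= addrC; apply: dilate_increasing => // j.
by have := S_coord i w j; rewrite /S => ->; rewrite sumr_ge0.
Qed.

End ruin_event.

(** * Multivariate regular variation *)

Section ereal_compactness.
Context {R : realType}.

(** An ultrafilter converges to the supremum [s] of the points whose closed upper ray it contains:
    it contains the upper ray from any point below [s] and the lower ray from any point above. This
    yields compactness of [far t], infinite points included, hence finite mass there. *)
Lemma ereal_compact : compact [set: \bar R].
Proof.
rewrite compact_ultra => F UF _.
pose s := ereal_sup [set x : \bar R | F [set y | (x <= y)%E]].
exists s; split => //.
have lt_s x : (x < s)%E -> F [set y | (x < y)%E].
  move=> /ereal_sup_gt[z Fz xz]; apply: filterS Fz => y /=.
  exact: lt_le_trans.
have gt_s x : (s < x)%E -> F [set y | (y < x)%E].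
  move=> sx; have [Fx|] := in_ultra_setVsetC [set y | (x <= y)%E] UF.
    by move: sx; rewrite ltNge => /negP[]; exact: ereal_sup_ubound.
  by apply: filterS => y /= /negP; rewrite -ltNge.
move=> B; case: s lt_s gt_s => [r||] lt_s gt_s.
- move=> nB; have /nbhs_ballP[e e0 eB] : nbhs r (fun y : R => B y%:E) := nB.
  have h1 : F [set y | ((r - e)%:E < y)%E] by apply: lt_s; rewrite lte_fin gtrBl.
  have h2 : F [set y | (y < (r + e)%:E)%E] by apply: gt_s; rewrite lte_fin ltrDl.
  apply: filterS (filterI h1 h2) => -[y| |] [] //=.
  rewrite !lte_fin => y1 y2; apply: eB.
  by rewrite /ball/= ltr_norml; apply/andP; split; lra.
- move=> [M [_ MB]]; have FM : F [set y | (M%:E < y)%E] by apply: lt_s; rewrite ltry.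
  exact: filterS MB FM.
- move=> [M [_ MB]]; have FM : F [set y | (y < M%:E)%E] by apply: gt_s; rewrite ltNyr.
  exact: filterS MB FM.
Qed.

End ereal_compactness.

Section null_member.
Context {R : realType} d (T : measurableType d) (mu : {measure set T -> \bar R}).

(* Only countably many disjoint sets can be non-null in a space of finite measure. *)
Lemma exists_null_member (D : R -> set T) (K : set T) (a b : R) : a < b ->
  (forall t, measurable (D t)) ->
  (forall s t, a < s < b -> a < t < b -> s != t -> D s `&` D t = set0) ->
  measurable K -> (forall t, a < t < b -> D t `<=` K) -> (mu K < +oo)%E ->
  exists2 t, a < t < b & mu (D t) = 0%E.
Proof.
move=> ab mD trivD mK DK Kfin; apply: contrapT => /forall2NP nz.
pose S n := [set t | a < t < b /\ (n.+1%:R^-1%:E <= mu (D t))%E].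
have finS n : finite_set (S n).
  apply: contrapT => infS.
  (* N + 1 disjoint subsets of [K], each of mass at least 1/(n+1), would have total mass above
     [mu K]. *)
  pose N := Num.truncn (fine (mu K) * n.+1%:R).
  have [B BS NB] := infinite_set_fset N.+1 infS.
  have triv : trivIset [set` B] D.
    apply/trivIsetP => s t /BS[sab _] /BS[tab _] st; exact: trivD.
  have le1 : (mu (\big[setU/set0]_(t <- B) D t) <= mu K)%E.
    rewrite -bigcup_fset; apply: le_measure.
    - by apply/mem_set/fin_bigcup_measurable => //; exact: finite_fset.
    - exact/mem_set.
    - by move=> w [t /= tB Dw]; have [tab _] := BS _ tB; exact: (DK t).
  move: le1; rewrite measure_fbigsetU//; apply/negP; rewrite -ltNge.
  apply: (@lt_le_trans _ _ (\sum_(t <- B) (n.+1%:R^-1)%:E)%E); last first.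
    by rewrite big_seq [leRHS]big_seq; apply: lee_sum => t tB; have [] := BS _ tB.
  rewrite sumEFin big_const_seq count_predT iter_addr addr0.
  rewrite -(@fineK _ (mu K)) ?ge0_fin_numE// lte_fin -[ltRHS]mulr_natl ltr_pdivlMr ?ltr0n//.
  apply: lt_le_trans (_ : N.+1%:R <= _); last by rewrite ler_nat.
  have muN : 0 <= fine (mu K) * n.+1%:R by rewrite mulr_ge0 ?fine_ge0.
  by have /andP[] := truncn_itv muN.
(* If no member were null, the interval would be the union of the finite sets [S n]; being countable
   it would have Lebesgue measure 0 instead of b - a. *)
have : countable `]a, b[%classic.
  apply: (@sub_countable _ _ _ (\bigcup_n S n)).
    apply: subset_card_le => t /=; rewrite in_itv/= => tab.
    have mut : (0 < mu (D t))%E.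
      rewrite lt0e measure_ge0 andbT; apply/eqP => mu0.
      by case: (nz t) => // /negP.
    have [n Hn] : exists n : nat, (n.+1%:R^-1%:E <= mu (D t))%E.
      have mufin : mu (D t) \is a fin_num.
        rewrite ge0_fin_numE// (le_lt_trans _ Kfin)//.
        by apply: le_measure; [exact/mem_set|exact/mem_set|exact: DK].
      exists (Num.truncn (fine (mu (D t)))^-1).
      have f0 : 0 < fine (mu (D t)) by rewrite fine_gt0// mut -ge0_fin_numE.
      rewrite -[leRHS]fineK// lee_fin invf_ple ?posrE ?ltr0n//.
      have f1 : 0 <= (fine (mu (D t)))^-1 by rewrite invr_ge0 ltW.
      by have /andP[_ /ltW] := truncn_itv f1.
    by exists n.
  by apply: bigcup_countable => // n _; exact: finite_set_countable.
move=> /countable_lebesgue_measure0; rewrite lebesgue_measure_itv/= lte_fin ab.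
by move=> /eqP; rewrite eqe subr_eq0 gt_eqF.
Qed.

End null_member.

Section regular_variation.
Context {R : realType}.
Implicit Types G g m : R -> R.

(** If [G] vanished at a point it would vanish from there on, and the quotients, with division by 0
    equal to 0, could not tend to 2^(-alpha) > 0. *)
Lemma regularly_varying_gt0 G alpha : (forall x, 0 <= G x) ->
  {homo G : x y /~ x <= y} -> regularly_varying alpha G -> forall x, 0 < G x.
Proof.
move=> G0 Gmono rv x; have r2 : 0 < (2 : R) by rewrite ltr0n.
have := rv 2 r2.
have p0 : 0 < (2 : R) `^ (- alpha) by rewrite powR_gt0.
move=> /cvgr_gt /(_ _ p0) h.
have [y [xy]] := filter_ex (filterI (nbhs_pinfty_ge (num_real x)) h).
apply: contraPT; rewrite -leNgt => Gx.
have -> : G y = 0 by apply/eqP; rewrite eq_le G0 andbT (le_trans (Gmono _ _ xy)).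
by rewrite invr0 mulr0 ltxx.
Qed.

(** The scale 1 need not be good, so the limit of [g / G] is obtained from a good scale t by
    replacing x with x/t. Uniqueness of that limit compares any two good scales and forces the
    homogeneity of [m]. *)
Lemma regular_variation_scaling G g m (good : R -> Prop) alpha :
  (forall x, 0 < G x) -> regularly_varying alpha G ->
  (forall a b, 0 < a < b -> exists2 t, a < t < b & good t) ->
  (forall t, 0 < t -> good t -> g (t * x) / G x @[x --> +oo] --> m t) ->
  exists2 l : R, g x / G x @[x --> +oo] --> l &
    forall t, 0 < t -> good t -> m t = l * t `^ (- alpha).
Proof.
move=> G0 rv dense gm.
have lim0 t : 0 < t -> good t -> g x / G x @[x --> +oo] --> m t * t `^ alpha.
  move=> t0 good_t; have ti0 : 0 < t^-1 by rewrite invr_gt0.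
  have -> : t `^ alpha = t^-1 `^ (- alpha).
    by rewrite -powR_inv1 ?(ltW t0)// -powRrM mulN1r opprK.
  apply: (cvg_pinfty_ext _ (cvgM_pinfty (cvg_pinfty_scale ti0 (gm t t0 good_t)) (rv _ ti0))).
  move=> x /=; rewrite [t * (t^-1 * x)]mulrA divff ?gt_eqF// mul1r.
  by rewrite mulrA divfK ?gt_eqF.
have [|t /andP[t1 _] good_t] := dense 1 2; first by rewrite ltr01 ltr1n.
have t0 : 0 < t by exact: lt_trans t1.
exists (m t * t `^ alpha); first exact: lim0.
move=> s s0 good_s.
have -> : m t * t `^ alpha = m s * s `^ alpha.
  by apply: (cvg_unique _ (lim0 _ t0 good_t) (lim0 _ s0 good_s)).
by rewrite powRN mulfK// gt_eqF// powR_gt0.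
Qed.

End regular_variation.

Section extended_space.
Context {R : realType} {d : nat}.
Implicit Types (z : 'rV[\bar R]_d) (y : 'rV[R]_d).

Definition far (t : R) : set 'rV[\bar R]_d := [set z | exists j, (t%:E <= `|z ord0 j|)%E].

Definition beyond (t : R) : set 'rV[\bar R]_d := [set z | exists j, (t%:E < `|z ord0 j|)%E].

Definition infinite_points : set 'rV[\bar R]_d := [set z | exists j, (`|z ord0 j| = +oo)%E].

Lemma open_abse_lt (t : R) : open [set u : \bar R | (`|u| < t%:E)%E].
Proof.
apply: (@open_comp _ _ abse [set u | (u < t%:E)%E]); last exact: open_ereal_lt_ereal.
by move=> u _; apply: cvg_abse; exact: cvg_id.
Qed.

Lemma open_abse_gt (t : R) : open [set u : \bar R | (t%:E < `|u|)%E].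
Proof.
apply: (@open_comp _ _ abse [set u | (t%:E < u)%E]); last exact: open_ereal_gt_ereal.
by move=> u _; apply: cvg_abse; exact: cvg_id.
Qed.

Lemma closed_far t : closed (far t).
Proof.
rewrite -openC openE => z /= nz.
exists (fun _ _ => [set u : \bar R | (`|u| < t%:E)%E]) => [i j|w Hw [j]].
  apply: open_nbhs_nbhs; split; first exact: open_abse_lt.
  by rewrite /= ltNge (ord1 i); apply/negP => tz; apply: nz; exists j.
by rewrite leNgt => /negP; apply; exact: Hw.
Qed.

Lemma compact_far t : compact (far t).
Proof.
apply: (@subclosed_compact _ _ setT) => //; first exact: closed_far.
rewrite [X in compact X](_ : _ =
    [set v : 'rV[\bar R]_d | forall i, [set: \bar R] (v ord0 i)]).
  exact: (rV_compact (fun _ : 'I_d => ereal_compact)).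
by apply/seteqP; split.
Qed.

Lemma open_beyond t : open (beyond t).
Proof.
rewrite openE => z [j tz].
exists (fun _ k => if k == j then [set u : \bar R | (t%:E < `|u|)%E] else setT) => [i k|w Hw].
  rewrite (ord1 i); case: eqP => [->|_]; last exact: filterT.
  by apply: open_nbhs_nbhs; split => //; exact: open_abse_gt.
by exists j; have := Hw ord0 j; rewrite eqxx.
Qed.

Lemma far_0 t : 0 < t -> ~ far t 0.
Proof. by move=> t0 [j]; rewrite mxE abse0 lee_fin leNgt t0. Qed.

Lemma embed_inj : injective (@embed R d).
Proof.
by move=> x y /rowP xy; apply/rowP => j; have := xy j; rewrite !mxE => -[].
Qed.

Lemma open_embed (O : set 'rV[R]_d) : open O -> open (embed @` O).
Proof.
move=> oO; rewrite openE => _ [y Oy <-].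
have [Q yQ QO] : nbhs y O by exact: open_nbhs_nbhs.
exists (fun i j => EFin @` Q i j) => [i j|w Hw].
  rewrite mxE; apply: filterS (yQ i j : nbhs (y i j) (Q i j)).
  by move=> u Qu; exists u.
have wE i j : w i j = (fine (w i j))%:E by have [u _ <-] := Hw i j.
exists (map_mx fine w); last by apply/matrixP => i j; rewrite !mxE -wE.
by apply: QO => i j; rewrite mxE; have [u Qu <-] := Hw i j.
Qed.

Lemma embed_continuous : continuous (@embed R d).
Proof.
move=> y B [Q yQ QB]; exists (fun i j => [set u | Q i j u%:E]) => [i j|w Hw].
  by have := yQ i j; rewrite mxE.
by apply: QB => i j; rewrite mxE; exact: Hw.
Qed.

Lemma edilateP x (B : set 'rV[\bar R]_d) y : 0 < x ->
  (embed @^-1` edilate x B) y <-> B (embed (x^-1 *: y)).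
Proof.
move=> x0; split=> [[b Bb bE]|By].
  rewrite (_ : embed _ = b)//; apply/rowP => j; have /rowP/(_ j) := bE.
  rewrite !mxE; case: (b 0 j) => [u||].
  - by rewrite -EFinM => -[<-]; rewrite mulrA mulVf ?gt_eqF// mul1r.
  - by rewrite gt0_muley ?lte_fin.
  - by rewrite gt0_muleNy ?lte_fin.
exists (embed (x^-1 *: y)) => //; apply/rowP => j; rewrite !mxE -EFinM.
by rewrite mulrA divff ?gt_eqF// mul1r.
Qed.

Lemma measurable_open_erv (B : set 'rV[\bar R]_d) : open B ->
  measurable (B : set (borelERV R d)).
Proof. by move=> oB; exact: sub_sigma_algebra. Qed.

Lemma measurable_closed_erv (B : set 'rV[\bar R]_d) : closed B ->
  measurable (B : set (borelERV R d)).
Proof.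
by move=> cB; rewrite -[B]setCK; apply: measurableC; apply: measurable_open_erv;
  exact: closed_openC.
Qed.

Lemma measurable_eboundary (B : set 'rV[\bar R]_d) :
  measurable (eboundary B : set (borelERV R d)).
Proof.
apply: measurableD.
  by apply: measurable_closed_erv; exact: closed_closure.
by apply: measurable_open_erv; exact: open_interior.
Qed.

Lemma infinite_points_beyond t : infinite_points `<=` beyond t.
Proof. by move=> z [j zj]; exists j; rewrite zj ltry. Qed.

Lemma measurable_infinite_points : measurable (infinite_points : set (borelERV R d)).
Proof.
rewrite [X in measurable X](_ : _ = \bigcap_n beyond n%:R).
  by apply: bigcap_measurableType => n _; apply: measurable_open_erv; exact: open_beyond.
apply/seteqP; split => [z zi n _|z Hz]; first exact: infinite_points_beyond.
apply: contrapT => nz.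
have fz j : z ord0 j \is a fin_num.
  by rewrite fin_num_abs ltey; apply/eqP => zj; apply: nz; exists j.
pose M := Num.truncn (\sum_j `|fine (z ord0 j)|).
have [j] := Hz M.+1 Logic.I; apply/negP; rewrite -leNgt.
rewrite -(fineK (fz j)) /= lee_fin.
have s0 : 0 <= \sum_j `|fine (z ord0 j)| by rewrite sumr_ge0.
apply: (@le_trans _ _ (\sum_j `|fine (z ord0 j)|)).
  by rewrite (bigD1 j)//= lerDl sumr_ge0.
by have /andP[_ /ltW] := truncn_itv s0.
Qed.

End extended_space.

Section boundaries.
Context {R : realType} {d : nat}.

Lemma eboundary_sub (U B : set 'rV[\bar R]_d) : open U -> closed B -> U `<=` B ->
  eboundary U `<=` B `\` U.
Proof.
move=> oU cB UB z [zU nzU]; rewrite ((interior_id U).1 oU) in nzU; split => //.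
by rewrite ((closure_id B).1 cB); exact: closureS zU.
Qed.

End boundaries.

Section multivariate_regular_variation.
Context {R : realType} {d : nat}.
Variables (F : probability (borelRV R d) R) (alpha : R)
  (mu : {measure set (borelERV R d) -> \bar R})
  (V : probability (measurableTypeR R) R).
Hypothesis mrvF : MRV F alpha mu V.

Local Notation G := (tail V idfun).

Let mid : measurable_fun setT (idfun : measurableTypeR R -> R).
Proof. exact: measurable_id. Qed.

Lemma normalizing_tail_gt0 x : 0 < G x.
Proof.
case: mrvF => _ rv _ _ _; apply: regularly_varying_gt0 rv x => [x|].
  exact: tail_ge0.
by apply: tail_mono.
Qed.

Lemma mrv_finite (B : set 'rV[\bar R]_d) t : 0 < t -> B `<=` far t ->
  measurable (B : set (borelERV R d)) -> (mu B < +oo)%E.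
Proof.
move=> t0 Bt mB; case: mrvF => _ _ [_ radon] _ _.
apply: le_lt_trans (radon (far t) (@compact_far _ _ t) (far_0 t0)).
by apply: le_measure => //; apply/mem_set => //; apply: measurable_closed_erv; exact: closed_far.
Qed.

Lemma measurable_edilate (B : set 'rV[\bar R]_d) x : 0 < x -> open B ->
  measurable (embed @^-1` edilate x B : set (borelRV R d)).
Proof.
move=> x0 oB; apply: sub_sigma_algebra => /=.
rewrite [X in open X](_ : _ = (fun y : 'rV[R]_d => x^-1 *: y) @^-1` (embed @^-1` B)).
  apply: open_comp => [y _|]; first exact: scaler_continuous.
  by apply: open_comp => // y _; exact: embed_continuous.
by apply/seteqP; split => y; rewrite edilateP.
Qed.

Lemma mrv_limit (U : set 'rV[\bar R]_d) t : 0 < t -> U `<=` far t -> open U ->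
  mu (eboundary U) = 0%E ->
  fine (F (embed @^-1` edilate x U)) / G x @[x --> +oo] --> fine (mu U).
Proof.
move=> t0 Ut oU U0; case: (mrvF) => _ _ _ _ /(_ U (measurable_open_erv oU)).
have nU0 : ~ closure (U : set 'rV[\bar R]_d) 0.
  by move=> /(closureS Ut); rewrite -((closure_id (far t)).1 (@closed_far _ _ t)); exact: far_0.
have mufin : mu U \is a fin_num.
  by rewrite ge0_fin_numE// (mrv_finite t0 Ut)//; exact: measurable_open_erv.
move=> /(_ nU0 U0); rewrite -{1}(fineK mufin) => /fine_cvg.
apply: cvg_trans; apply: near_eq_cvg; near=> x.
have x0 : 0 < x by near: x; exact: nbhs_pinfty_gt.
have mx : F (embed @^-1` edilate x U) \is a fin_num.
  by rewrite fin_num_measure//; exact: measurable_edilate.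
by rewrite /= inver gt_eqF ?normalizing_tail_gt0// fineM.
Unshelve. all: end_near.
Qed.

(** Common core for two families: the complements of sup-norm balls and the dilates of the ruin set.
    The scaling assumption compares finite points only, which are all that [F] sees. *)
Lemma mrv_family (U : R -> set 'rV[\bar R]_d) c : 0 < c ->
  (forall t, 0 < t -> open (U t)) -> (forall t, 0 < t -> U t `<=` far (c * t)) ->
  (forall x t, 0 < x -> 0 < t ->
    embed @^-1` edilate x (U t) = embed @^-1` (U (t * x))) ->
  (forall a b, 0 < a < b -> exists2 t, a < t < b & mu (eboundary (U t)) = 0%E) ->
  exists2 l : R, fine (F (embed @^-1` U x)) / G x @[x --> +oo] --> l &
    forall a b, 0 < a < b -> exists2 t, a < t < b & mu (U t) = (l * t `^ (- alpha))%:E.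
Proof.
move=> c0 oU Uc Ux dense; case: (mrvF) => _ rv _ _ _.
pose good t := mu (eboundary (U t)) = 0%E.
have Ulim t : 0 < t -> good t ->
    fine (F (embed @^-1` U (t * x))) / G x @[x --> +oo] --> fine (mu (U t)).
  move=> t0 gt; have ct0 : 0 < c * t by rewrite mulr_gt0.
  have := mrv_limit ct0 (Uc t t0) (oU t t0) gt.
  apply: cvg_trans; apply: near_eq_cvg; near=> x.
  have x0 : 0 < x by near: x; exact: nbhs_pinfty_gt.
  by rewrite Ux.
have [l lim_l lE] := @regular_variation_scaling _ G (fun y => fine (F (embed @^-1` U y)))
  (fun t => fine (mu (U t))) good alpha normalizing_tail_gt0 rv dense Ulim.
exists l => // a b /[dup] ab0 /andP[a0 ab].
have [t /[dup] tab /andP[at_ _] gt] := dense a b ab0; exists t => //.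
have t0 : 0 < t by exact: lt_trans at_.
rewrite -lE// fineK// ge0_fin_numE//; apply: (@mrv_finite _ (c * t)).
- by rewrite mulr_gt0.
- exact: Uc.
- by apply: measurable_open_erv; exact: oU.
Unshelve. all: end_near.
Qed.

Lemma beyond_sub_far t : beyond t `<=` (far t : set 'rV[\bar R]_d).
Proof. by move=> z [j tz]; exists j; exact: ltW. Qed.

(** The boundary of [beyond t] lies in the sup-norm sphere of radius t; these spheres are disjoint
    and, for t > a, contained in [far a], which has finite mass. Besides the mass of the infinite
    points, this gives the tail of the largest component of a claim. *)
Lemma mrv_beyond : exists2 l : R,
  fine (F [set y : 'rV[R]_d | exists j, x < `|y 0 j|]) / G x @[x --> +oo] --> l &
  forall a b, 0 < a < b ->
    exists2 t, a < t < b & mu (beyond t) = (l * t `^ (- alpha))%:E.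
Proof.
have [|||a b /andP[a0 ab]|l lim_l lE] := @mrv_family beyond 1 ltr01.
- by move=> t _; exact: open_beyond.
- by move=> t _; rewrite mul1r; exact: beyond_sub_far.
- move=> x t x0 t0; apply/seteqP; split => y; rewrite edilateP//=.
    move=> [j]; rewrite /embed !mxE /= lte_fin normrM gtr0_norm ?invr_gt0// ltr_pdivlMl// => tx.
    by exists j; rewrite !mxE /= lte_fin mulrC.
  move=> [j]; rewrite /embed !mxE /= lte_fin => tx.
  exists j; rewrite !mxE /= lte_fin normrM gtr0_norm ?invr_gt0// ltr_pdivlMl//.
  by rewrite mulrC.
- have eb t : eboundary (beyond t) `<=` far t `\` (beyond t : set 'rV[\bar R]_d).
    exact: eboundary_sub (@open_beyond _ _ t) (@closed_far _ _ t) (@beyond_sub_far t).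
  apply: (@exists_null_member _ _ _ mu (fun t => eboundary (beyond t)) (far a)) => //.
  + by move=> t; exact: measurable_eboundary.
  + have aux (s t : R) : s < t ->
        eboundary (beyond s) `&` eboundary (beyond t) = set0 :> set 'rV[\bar R]_d.
      move=> st; apply/seteqP; split => // z [zs zt].
      have [_ nsz] := eb s z zs; have [[j tz] _] := eb t z zt; apply: nsz.
      by exists j; apply: lt_le_trans tz; rewrite lte_fin.
    by move=> s t _ _; rewrite neq_lt => /orP[|] /aux //; rewrite setIC.
  + by apply: measurable_closed_erv; exact: closed_far.
  + move=> t /andP[at_ _] z zt; have [[j tz] _] := eb t z zt; exists j; apply: le_trans tz.
    by rewrite lee_fin ltW.
  + by apply: (mrv_finite a0) => //; apply: measurable_closed_erv; exact: closed_far.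
- exists l => //; move: lim_l; apply: cvg_pinfty_ext => x; congr (fine (F _) / _).
  by apply/seteqP; split => y [j]; [rewrite mxE /= lte_fin; exists j|
    move=> xy; exists j; rewrite mxE /= lte_fin].
Qed.

Lemma mrv_infinite_points : mu infinite_points = 0%E.
Proof.
case: (mrvF) => al0 _ _ _ _; have [l lim_l lE] := mrv_beyond.
apply: contrapT => /eqP nz.
have le_inf t : (mu infinite_points <= mu (beyond t))%E.
  apply: le_measure; [| |exact: infinite_points_beyond]; apply/mem_set.
    exact: measurable_infinite_points.
  by apply: measurable_open_erv; exact: open_beyond.
have [|t1 _ mt1] := lE 1 2; first by rewrite ltr01 ltr1n.
have fin_inf : mu infinite_points \is a fin_num.
  by rewrite ge0_fin_numE// (le_lt_trans (le_inf t1))// mt1 ltry.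
pose m := fine (mu infinite_points).
have m0 : 0 < m by rewrite fine_gt0// lt0e nz measure_ge0 -ge0_fin_numE.
(* For t > a this gives m t^alpha >= |l| + m > l, so [beyond t] would have mass l t^(-alpha) < m
   although it contains all infinite points. *)
pose a := (`|l| / m + 1) `^ alpha^-1.
have b0 : 0 < `|l| / m + 1 by rewrite ltr_wpDl// divr_ge0// ltW.
have a0 : 0 < a by rewrite powR_gt0.
have [|t /andP[at_ _] mt] := lE a (a + 1); first by rewrite a0/= ltrDl ltr01.
have t0 : 0 < t by exact: lt_trans at_.
have : m <= l * t `^ (- alpha) by rewrite -lee_fin fineK// -mt.
have tal : `|l| / m + 1 <= t `^ alpha.
  rewrite [leLHS](_ : _ = a `^ alpha); last first.
    by rewrite /a -powRrM mulVf ?gt_eqF// powRr1// ltW.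
  by rewrite ge0_ler_powR ?nnegrE ?(ltW al0) ?(ltW a0) ?(ltW t0) ?(ltW at_).
rewrite powRN ler_pdivlMr ?powR_gt0// => mt_l.
have := le_trans (ler_wpM2l (ltW m0) tal) mt_l.
rewrite mulrDr mulr1 mulrC divfK ?gt_eqF// leNgt => /negP; apply.
by rewrite (le_lt_trans (ler_norm l))// ltrDl.
Qed.

Variable A : set 'rV[R]_d.
Hypothesis ruinA : ruin_set A.

Let U t : set 'rV[\bar R]_d := embed @` dilate t A.

Let U_embed t y : U t (embed y) <-> dilate t A y.
Proof. by split=> [[x Ax /embed_inj <-]//|Ay]; exists y. Qed.

(** Let y' in tA be close to y. Then y'/t is the convex combination of y/s and b = (y'-y)/(t-s) with
    weight s/t on the first. The radius e = delta (t-s) makes b too small to lie in [A], so y/s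
    outside [A] would contradict convexity of the complement. Consequently boundaries of different
    dilates share no finite point. *)
Lemma closure_dilate s t (y : 'rV[R]_d) : 0 < s < t ->
  closure (U t) (embed y) -> dilate s A y.
Proof.
move=> /andP[s0 st] cUy; have t0 : 0 < t by exact: lt_trans st.
have [delta delta0 Hd] := ruin_set_away ruinA.
rewrite dilateP ?gt_eqF//; apply: contrapT => nAs.
pose e := delta * (t - s).
have e0 : 0 < e by rewrite mulr_gt0// subr_gt0.
have nb : nbhs (embed y) (embed @` ball y e).
  by apply: open_nbhs_nbhs; split; [apply: open_embed; exact: ball_open|exists y => //;
    exact: ballxx].
have [z [Uz [y' [_ yy'] y'z]]] := cUy _ nb.
move: Uz; rewrite -y'z => /U_embed; rewrite dilateP ?gt_eqF// => At.
pose b := (t - s)^-1 *: (y' - y).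
have nAb : ~ A b.
  move=> /Hd[j]; rewrite leNgt => /negP; apply.
  rewrite !mxE normrM gtr0_norm ?invr_gt0 ?subr_gt0// ltr_pdivrMl ?subr_gt0// mulrC.
  by have := yy' ord0 j; rewrite /ball/= distrC.
have st01 : 0 <= s / t <= 1.
  by rewrite divr_ge0 ?(ltW s0) ?(ltW t0)//= ler_pdivrMr// mul1r ltW.
apply: (ruin_set_convexC ruinA st01 nAs nAb).
rewrite (_ : _ + _ = t^-1 *: y')//.
apply/rowP => j; rewrite !mxE; field.
by rewrite !gt_eqF ?subr_gt0.
Qed.

Let openU t : 0 < t -> open (U t).
Proof. by move=> t0; apply: open_embed; exact: dilate_open. Qed.

Let U_le s t : 0 < s <= t -> U t `<=` U s.
Proof. by move=> st _ [y Ay <-]; exists y => //; exact: dilate_le st Ay. Qed.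

Let continuous_powR1 (l e : R) : 0 < e ->
  exists2 a, 0 < a & forall t, 1 - a < t < 1 + a -> `|l - l * t `^ (- alpha)| < e.
Proof.
move=> e0; have h : l * t `^ (- alpha) @[t --> (1 : R)] --> l * 1 `^ (- alpha).
  apply: cvgM; first exact: cvg_cst.
  apply: (@continuous_cvg _ _ _ _ _ _ (fun u => u `^ (- alpha))) => //.
  apply: differentiable_continuous; apply/derivable1_diffP.
  by apply: derivable_powR; rewrite in_itv/= ltr01.
rewrite powR1 mulr1 in h; move/cvgrPdist_lt : h => /(_ e e0) /nbhs_ballP[a a0 Ha].
exists a => // t /andP[t1 t2]; apply: Ha; rewrite /ball/= ltr_norml.
by apply/andP; split; lra.
Qed.

(** The boundary of [A] itself is not known to be null. The formula mu(tA) = l t^(-alpha) holds for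
    scales t arbitrarily close to 1 on both sides, and since the dilates decrease in t it squeezes
    mu(A) to l. *)
Lemma mrv_ruin : exists2 l : R, mu (embed @` A) = l%:E &
  tail F (radius_on A) x / G x @[x --> +oo] --> l.
Proof.
have [delta delta0 Hd] := ruin_set_away ruinA.
have Ufar t : 0 < t -> U t `<=` far (delta * t).
  move=> t0 _ [y + <-]; rewrite dilateP ?gt_eqF// => /Hd[j]; rewrite mxE normrM.
  rewrite gtr0_norm ?invr_gt0// ler_pdivlMl// => tj; exists j.
  by rewrite mxE /= lee_fin mulrC.
have [|a b /andP[a0 ab]|l lim_l lE] := @mrv_family U delta delta0 openU Ufar.
- move=> x t x0 t0; apply/seteqP; split => y; rewrite edilateP// => /U_embed h;
    apply/U_embed; move: h; rewrite !dilateP ?gt_eqF ?mulr_gt0// scalerA -invfM mulrC //.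
- have eb t : 0 < t -> eboundary (U t) `<=` far (delta * t) `\` U t.
    by move=> t0; exact: eboundary_sub (openU t0) (@closed_far _ _ _) (Ufar t t0).
  (* [closure_dilate] separates the boundaries at finite points only; the infinite points removed
     here are null by [mrv_infinite_points]. *)
  pose D t := eboundary (U t) `\` infinite_points.
  have [||||||t tab Dt0] := @exists_null_member _ _ _ mu D (far (delta * a)) a b => //.
  + by move=> t; apply: measurableD;
    [exact: measurable_eboundary|exact: measurable_infinite_points].
  + have aux s t : 0 < s -> s < t -> D s `&` D t = set0.
      move=> s0 st; apply/seteqP; split => // z [[zs nz] [zt _]].
      have zE : z = embed (map_mx fine z).
        apply/rowP => j; rewrite !mxE fineK// fin_num_abs ltey.
        by apply/eqP => zj; apply: nz; exists j.
      have [_ nUs] := eb s s0 z zs; apply: nUs.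
      rewrite zE; apply/U_embed; apply: (@closure_dilate s t); first by rewrite s0.
      by rewrite -zE; case: zt.
    move=> s t /andP[as_ _] /andP[at_ _]; rewrite neq_lt => /orP[st|ts].
      by apply: aux => //; exact: lt_trans as_.
    by rewrite setIC; apply: aux => //; exact: lt_trans at_.
  + by apply: measurable_closed_erv; exact: closed_far.
  + move=> t /andP[at_ _] z [zt _]; have [[j tz] _] := eb t (lt_trans a0 at_) z zt.
    by exists j; apply: le_trans tz; rewrite lee_fin ler_wpM2l ?(ltW delta0)// ltW.
  + apply: (@mrv_finite _ (delta * a)) => //; first by rewrite mulr_gt0.
    by apply: measurable_closed_erv; exact: closed_far.
  exists t => //; apply/eqP; rewrite eq_le measure_ge0 andbT.
  rewrite (measureDI _ (measurable_eboundary _) measurable_infinite_points).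
  rewrite [X in (X + _)%E](_ : _ = 0%E); last exact: Dt0.
  rewrite add0e.
  rewrite -mrv_infinite_points; apply: le_measure; [| |exact: subIsetr]; apply/mem_set.
    by apply: measurableI; [exact: measurable_eboundary|exact: measurable_infinite_points].
  exact: measurable_infinite_points.
have A1 : embed @` A = U 1.
  congr (_ @` _); apply/seteqP; split => y; rewrite dilateP ?oner_eq0// invr1 scale1r //.
have mU t : 0 < t -> measurable (U t : set (borelERV R d)).
  by move=> t0; apply: measurable_open_erv; exact: openU.
have fin1 : mu (U 1) \is a fin_num.
  rewrite ge0_fin_numE//; apply: (@mrv_finite _ (delta * 1));
    [by rewrite mulr1|exact: Ufar|exact: mU].
exists l.
  rewrite A1 -(fineK fin1); congr EFin; apply/eqP; rewrite eq_le; apply/andP; split.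
    apply/ler_addgt0Pr => e e0; have [a a0 Ha] := continuous_powR1 l e0.
    (* The bound 1/2 keeps the scale positive when a >= 1. *)
    have [|t /andP[ta t1] mt] := lE (Num.max (1 - a) (1 / 2)) 1.
      by rewrite lt_max gt_max !gtrDl oppr_lt0 a0 /=; apply/andP; split; [apply/orP; right|]; lra.
    rewrite gt_max in ta; case/andP : ta => ta t2.
    have t0 : 0 < t by apply: lt_trans t2; lra.
    have : (mu (U 1) <= mu (U t))%E.
      by apply: le_measure; [by apply/mem_set; exact: mU|by apply/mem_set;
        exact: mU|apply: U_le; rewrite t0 ltW].
    rewrite mt -(fineK fin1) lee_fin => /le_trans; apply.
    have /Ha : 1 - a < t < 1 + a by apply/andP; split; lra.
    by rewrite ltr_norml => /andP[+ _]; lra.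
  apply/ler_addgt0Pr => e e0; have [a a0 Ha] := continuous_powR1 l e0.
  have [|t /andP[t1 ta] mt] := lE 1 (1 + a); first by rewrite ltr01 ltrDl.
  have t0 : 0 < t by exact: lt_trans t1.
  have : (mu (U t) <= mu (U 1))%E.
    by apply: le_measure; [by apply/mem_set; exact: mU|by apply/mem_set; exact: mU|apply: U_le;
      rewrite ltr01 ltW].
  rewrite mt -(fineK fin1) lee_fin => mt1.
  have /Ha : 1 - a < t < 1 + a by apply/andP; split; lra.
  by rewrite ltr_norml => /andP[_]; lra.
apply: cvg_trans lim_l; apply: near_eq_cvg; near=> x.
have x0 : 0 < x by near: x; exact: nbhs_pinfty_gt.
rewrite /tail; congr (fine (F _) / _).
apply/seteqP; split => y /=; first by move=> /U_embed; rewrite lt_radius_on.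
by rewrite lt_radius_on// => Ay; apply/U_embed.
Unshelve. all: end_near.
Qed.

End multivariate_regular_variation.

(** * Infinite horizon *)

Section tail_comparison.
Context {R : realType}.
Implicit Types f g : R -> R.

(** Turns an asymptotic bound into one for all x, as the series bound requires: beyond some M the
    ratio is below l + 1, and up to M one has f <= 1 <= g(x)/g(M). *)
Lemma tail_domination f g (l : R) : (forall x, f x <= 1) -> (forall x, 0 < g x) ->
  {homo g : x y /~ x <= y} -> f x / g x @[x --> +oo] --> l ->
  exists2 B, 0 <= B & forall x, f x <= B * g x.
Proof.
move=> f1 g0 gmono fg.
have l1 : l < l + 1 by rewrite ltrDl.
have /cvgr_lt /(_ _ l1) [M [_ HM]] := fg.
exists (Num.max (l + 1) (g M)^-1); first by rewrite le_max invr_ge0 (ltW (g0 _)) orbT.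
move=> x; have [xM|Mx] := leP x M.
  apply: (@le_trans _ _ ((g M)^-1 * g x)).
    by rewrite (le_trans (f1 x))// mulrC ler_pdivlMr// mul1r gmono.
  by rewrite ler_wpM2r ?(ltW (g0 _))// le_max lexx orbT.
rewrite -ler_pdivrMr// (le_trans (ltW (HM _ Mx)))// le_max lexx //.
Qed.

Lemma regularly_varying_equiv f g (l alpha : R) : (forall x, 0 < f x) -> (forall x, 0 < g x) ->
  0 < l -> f x / g x @[x --> +oo] --> l -> regularly_varying alpha g ->
  regularly_varying alpha f.
Proof.
move=> f0 g0 l0 fg rvg t t0.
have gf : (f x / g x)^-1 @[x --> +oo] --> l^-1 by apply: cvgV; rewrite ?gt_eqF.
have h := cvgM_pinfty (cvgM_pinfty (cvg_pinfty_scale t0 fg) (rvg t t0)) gf.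
rewrite mulrAC divff ?gt_eqF// mul1r in h.
apply: cvg_pinfty_ext h => x /=; rewrite invf_div.
by field; rewrite !gt_eqF.
Qed.

End tail_comparison.

Section sums.
Context {R : realType}.

Lemma nneseries_real_cvg (b : nat -> R) (c : nat -> \bar R) : (forall i, 0 <= b i) ->
  (forall i, ((b i)%:E <= c i)%E) -> (\sum_(0 <= i <oo) c i < +oo)%E ->
  cvgn (series b).
Proof.
move=> b0 bc csum; apply: nondecreasing_is_cvgn.
  by apply/nondecreasing_seqP => n; rewrite seriesSr lerDl.
have c0 i : (0 <= c i)%E by apply: le_trans (bc i); rewrite lee_fin.
have sfin : (\sum_(0 <= i <oo) c i)%E \is a fin_num.
  by rewrite ge0_fin_numE// nneseries_ge0.
exists (fine (\sum_(0 <= i <oo) c i)%E) => _ [n _ <-].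
rewrite -lee_fin fineK// /series/= -sumEFin.
apply: le_trans (nneseries_lim_ge n _); last by move=> i _ _; exact: c0.
by apply: lee_sum.
Qed.

Lemma series_tail_le (b : nat -> R) n N : (forall i, 0 <= b i) -> cvgn (series b) ->
  \sum_(n <= i < N) b i <= limn (series b) - series b n.
Proof.
move=> b0 cb.
have nd : nondecreasing_seq (series b).
  by apply/nondecreasing_seqP => k; rewrite seriesSr lerDl.
have le_lim k : series b k <= limn (series b) by exact: nondecreasing_cvgn_le.
have [nN|Nn] := leqP n N; last by rewrite big_geq ?subr_ge0// ltnW.
by rewrite -sub_series_geq// lerD2r.
Qed.

Lemma nneseries_cvg (e : nat -> R) (I : R) : (forall i, 0 <= e i) ->
  series e @ \oo --> I -> (\sum_(0 <= i <oo) (e i)%:E)%E = I%:E.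
Proof.
move=> e0 eI; apply/cvg_lim => //.
under eq_fun do rewrite sumEFin.
by apply: cvg_EFin; [exact: nearW|exact: eI].
Qed.

End sums.

Section finite_series.
Context {R : realType} d (T : measurableType d) (P : probability T R).
Variable Y : nat -> T -> R.
Hypothesis mY : forall i, measurable_fun setT (Y i).
Hypothesis Y_ge0 : forall i w, 0 <= Y i w.

Lemma measurable_series_infinite :
  measurable [set w | (\sum_(0 <= i <oo) (Y i w)%:E = +oo)%E].
Proof.
rewrite [X in measurable X](_ : _ = setT `&`
    (fun w => (\sum_(0 <= i <oo) (Y i w)%:E)%E) @^-1` [set +oo%E]); last by rewrite setTI.
have mS : measurable_fun setT (fun w => (\sum_(0 <= i <oo) (Y i w)%:E)%E).
  apply: ge0_emeasurable_sum => [i w _ _|i _]; first by rewrite lee_fin.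
  exact/measurable_EFinP.
by apply: mS => //; exact: emeasurable_set1.
Qed.

Lemma series_infinite_null :
  (forall e, 0 < e -> exists x,
    (P (\bigcup_N [set w | (x < \sum_(0 <= i < N) Y i w)%R]) <= e%:E)%E) ->
  P [set w | (\sum_(0 <= i <oo) (Y i w)%:E = +oo)%E] = 0%E.
Proof.
move=> HP; apply/eqP; rewrite eq_le measure_ge0 andbT; apply/lee_addgt0Pr => e e0.
rewrite add0e; have [x Hx] := HP e e0; apply: le_trans Hx.
apply: le_measure.
- by apply/mem_set; exact: measurable_series_infinite.
- apply/mem_set; apply: bigcup_measurable => N _; apply: measurable_superlevel.
  exact: measurable_sum.
- move=> w /= Yw; apply: contrapT => nY.
  suff : (\sum_(0 <= i <oo) (Y i w)%:E <= x%:E)%E by rewrite Yw leye_eq.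
  apply: lime_le; first by apply: is_cvg_nneseries => i _ _; rewrite lee_fin.
  apply: nearW => N; rewrite sumEFin lee_fin leNgt; apply/negP => xN.
  by apply: nY; exists N.
Qed.

End finite_series.

Section claims.
Context {R : realType} {dT : measure_display} {T : measurableType dT} (P : probability T R).

Lemma independent_seqs_pair {dU : measure_display} {U : measurableType dU}
    (Y : nat -> T -> U) (Z : nat -> T -> R) (g : U -> R) (h : R -> R) i :
  independent_seqs P Y Z -> measurable_fun setT g -> measurable_fun setT h ->
  indep_pair P (g \o Y i) (h \o Z i).
Proof.
move=> iYZ mg mh E1 E2 mE1 mE2; apply: iYZ; apply: sub_sigma_algebra; exists i => //.
  exists (g @^-1` E1); last by rewrite setTI.
  by rewrite -[X in measurable X]setTI; exact: mg.
exists (h @^-1` E2); last by rewrite setTI.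
by rewrite -[X in measurable X]setTI; exact: mh.
Qed.

Lemma integral_mean_measure (tau : nat -> {RV P >-> measurableTypeR R}) (f : R -> R) :
  (forall i w, 0 <= tau i w) -> measurable_fun setT f -> (forall s, 0 <= f s) ->
  (\int[mean_measure tau]_(s in `[0%R, +oo[) (f s)%:E)%E =
  (\sum_(0 <= i <oo) \int[P]_w (f (tau i w))%:E)%E.
Proof.
move=> tau0 mf f0.
have mfE (D : set (measurableTypeR R)) : measurable_fun D (fun s => (f s)%:E).
  by apply/measurable_EFinP; exact: measurable_funTS.
rewrite /mean_measure ge0_integral_measure_series//; last first.
  by move=> s _; rewrite lee_fin.
apply: eq_eseriesr => i _.
rewrite /distribution ge0_integral_pushforward//; last by move=> s _; rewrite lee_fin.
rewrite (_ : _ @^-1` _ = setT)//; apply/seteqP; split => // w _ /=.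
by rewrite in_itv/= andbT tau0.
Qed.

(** At the point x0/th the Potter bound is at most C th^q1, which is at most e for th =
    (e/C)^(1/q1), capped at 1. *)
Lemma potter_vanish (G : R -> R) q1 C x0 : 0 < q1 -> 0 < C -> 0 < x0 ->
  (forall x, G x <= 1) -> (forall x, 0 < G x) ->
  (forall x th, x0 <= x -> 0 < th <= 1 -> G (x / th) <= C * th `^ q1 * G x) ->
  forall e, 0 < e -> exists2 x, x0 <= x & G x <= e.
Proof.
move=> q10 C0 x00 G1 G0 HG e e0.
pose u := (e / C) `^ q1^-1; pose th := Num.min u 1.
have u0 : 0 < u by rewrite powR_gt0// divr_gt0.
have th0 : 0 < th by rewrite lt_min u0 ltr01.
have th1 : th <= 1 by rewrite ge_min lexx orbT.
exists (x0 / th); first by rewrite ler_peMr ?(ltW x00)// invf_ge1.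
apply: le_trans (HG x0 th (lexx _) _) _; first by rewrite th0.
apply: (@le_trans _ _ (C * th `^ q1)); first by rewrite ler_piMr// mulr_ge0 ?powR_ge0// ltW.
rewrite mulrC -ler_pdivlMr//.
apply: (@le_trans _ _ (u `^ q1)).
  by rewrite ge0_ler_powR ?nnegrE ?(ltW q10) ?(ltW u0) ?(ltW th0)// ge_min lexx.
by rewrite /u -powRrM mulVf ?gt_eqF// powRr1// divr_ge0// ltW.
Qed.

End claims.

(** The two properties of q on which the moment bound rests: q >= 1 for Jensen's inequality, and J+
    < q to leave room for a Potter exponent. *)
Lemma exponent_choice (R : realType) (J : \bar R) (q2 : R) :
  (0 < J)%E -> (J < q2%:E)%E ->
  let q := (0 < J < 1)%E%:R + q2 * (1 <= J)%E%:R in 1 <= q /\ (J < q%:E)%E.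
Proof.
move=> J0 Jq2 /=; rewrite J0 /=; have [J1|J1] := ltP J 1%E.
  by rewrite mulr0 addr0.
rewrite add0r mulr1; split => //.
by rewrite -lee_fin; apply: le_trans J1 (ltW Jq2).
Qed.

Theorem corollary3p2 (R : realType) (d : nat) (d_gt0 : (0 < d)%N)
  (dT : measure_display) (T : measurableType dT) (P : probability T R)
  (A : set 'rV[R]_d) (r : R) (F : probability (borelRV R d) R)
  (X : nat -> {RV P >-> borelRV R d})
  (tau : nat -> {RV P >-> measurableTypeR R})
  (alpha : R) (mu : {measure set (borelERV R d) -> \bar R})
  (V : probability (measurableTypeR R) R) :
  let FA := tail F (radius_on A) in
  let Jlo := matuszewska_lower FA in
  let Jup := matuszewska_upper FA in
  let integral_m := (\int[mean_measure tau]_(s in `[0%R, +oo[)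
                       (expR (- (alpha * r * s)))%:E)%E in
  let ruin x := P [set w | (embed @` dilate x A) (discounted_claims r X tau w)] in
  ruin_set A ->
  0 < r ->
  (forall i w (j : 'I_d), 0 <= (X i w : 'rV[R]_d) 0 j) ->
  (forall i w, (X i w : 'rV[R]_d) != 0) ->
  (forall i B, measurable B -> distribution P (X i) B = F B) ->
  (forall w, 0 <= tau 0%N w) ->
  (forall i w, tau i w <= tau i.+1 w) ->
  (forall t, 0 <= t -> (\int[P]_w claim_count tau t w < +oo)%E) ->
  independent_seqs P X tau ->
  consistently_varying FA ->
  positively_decreasing FA ->
  (exists q1 q2 : R,
    [/\ 0 < q1, (q1%:E < Jlo)%E, (Jlo <= Jup)%E, (Jup < q2%:E)%E &
        let q := (0 < Jup < 1)%E%:R + q2 * (1 <= Jup)%E%:R in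
        (\sum_(0 <= i <oo)
           poweR (maxe 'E_P[(fun w => expR (- (q1 * r * tau i w)))]
                       'E_P[(fun w => expR (- (q2 * r * tau i w)))]) q^-1
         < +oo)%E]) ->
  QAI_on P A X ->
  MRV F alpha mu V ->
  (mu (embed @` A) != 0%E ->
     asymp_equiv ruin
       (fun x => mu (embed @` A) * (tail V idfun x)%:E * integral_m)%E) /\
  (mu (embed @` A) = 0%E ->
     asymp_negligible ruin (fun x => (tail V idfun x)%:E)).
Proof.
move=> FA Jlo Jup integral_m ruin ruinA r0 X0 _ XF tau00 tau_mono _ indepXtau cvFA _
  [q1 [q2 [q10 q1J JJ Jq2]]].

(* The exponent q, the radii and the discount factors *)
have Jup0 : (0 < Jup)%E.
  by apply: lt_le_trans JJ; apply: lt_trans q1J; rewrite lte_fin.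
have [q_ge1 Jq] := exponent_choice Jup0 Jq2; cbv zeta.
set q := _ + _ in q_ge1 Jq *; move=> sum_fin qaiX mrvF.
have mrad : measurable_fun setT (radius_on A : borelRV R d -> R) by exact: measurable_radius_on.
pose W i w := radius_on A (X i w).
pose th i w := expR (- (r * tau i w)).
have tau0 i w : 0 <= tau i w by elim: i => // i IH; exact: le_trans (tau_mono i w).
have mh : measurable_fun setT (fun s : R => expR (- (r * s))).
  apply: measurableT_comp => //; apply: measurable_funN; exact: measurable_funM.
have mth i : measurable_fun setT (th i).
  exact: (measurableT_comp mh (measurable_funP (tau i))).
have mX i : measurable_fun setT (X i : T -> borelRV R d) by exact: measurable_funP.
have mW i : measurable_fun setT (W i) by exact: (measurableT_comp mrad (mX i)).
have W0 i w : 0 <= W i w by exact: radius_on_ge0.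
have th_gt0 i w : 0 < th i w by exact: expR_gt0.
have th01 i w : 0 < th i w <= 1.
  by rewrite th_gt0 -[leRHS]expR0 ler_expR oppr_le0 mulr_ge0// ltW.
have indep_g (g : 'rV[R]_d -> R) i : measurable_fun setT (g : borelRV R d -> R) ->
    indep_pair P (fun w => g (X i w)) (th i).
  by move=> mg; exact: (independent_seqs_pair i indepXtau mg mh).
have tail_g (g : 'rV[R]_d -> R) i : measurable_fun setT (g : borelRV R d -> R) ->
    tail P (fun w => g (X i w)) = tail F g.
  move=> mg; apply/funext => x; rewrite /tail -(XF i)//; exact: measurable_superlevel.
have tailW i : tail P (W i) = FA by exact: tail_g.
have FA0 : forall x, 0 < FA x by case: cvFA.
have FA1 x : FA x <= 1 by exact: tail_le1.
have FAmono : {homo FA : x y /~ x <= y} by exact: tail_mono.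

(* Potter bounds for F_A and uniform control of the remainders *)
have [v1 v1_gt1 nv1] := matuszewska_lower_near q10 q1J.
have [Cu [xu [Cu0 xu0 HCu]]] := potter_upper FA0 FAmono v1_gt1 (ltW q10) nv1.
(* The midpoint of J+ and q; the strict inequality p < q makes the layer sum a convergent geometric
   series. *)
have [p /andP[p0 pq] Jp] : exists2 p, 0 <= p < q & (Jup < p%:E)%E.
  have Jfin : Jup \is a fin_num by rewrite fin_numE; apply/andP; split; apply/eqP => JE;
    move: Jup0 Jq; rewrite JE.
  move: Jup0 Jq; rewrite -(fineK Jfin) !lte_fin => J0 Jq'.
  exists ((fine Jup + q) / 2); last by rewrite lte_fin midf_lt.
  by rewrite (midf_lt Jq').2 divr_ge0// addr_ge0// ltW// (lt_trans J0).
have [v2 v2_gt1 nv2] := matuszewska_upper_near Jup0 Jp.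
have [Cl [xl [Cl0 xl0 HCl]]] := potter_lower FA0 FA1 FAmono v2_gt1 p0 nv2.
pose x0 := Num.max xu xl.
have x00 : 0 < x0 by rewrite lt_max xu0.
have GCu x t : x0 <= x -> 0 < t <= 1 -> FA (x / t) <= Cu * t `^ q1 * FA x.
  by rewrite ge_max => /andP[xx _]; exact: HCu.
have GCl x l : x0 <= x -> 0 < l <= 1 -> FA (l * x) <= Cl * l `^ (- p) * FA x.
  by rewrite ge_max => /andP[_ xx]; exact: HCl.
have pq' : 0 <= p < q by rewrite p0.
pose b i := moment P th q1 i `^ q^-1.
have b0 i : 0 <= b i by exact: powR_ge0.
have momE := momentE P mth th01 (ltW q10).
have cb : cvgn (series b).
  apply: nneseries_real_cvg b0 _ sum_fin => i.
  rewrite /b -poweR_EFin; apply: gt0_ler_poweR.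
  - by rewrite invr_ge0 (le_trans ler01).
  - by rewrite in_itv/= leey andbT lee_fin; apply: ltW; apply: moment_gt0 => //; exact: ltW.
  - rewrite in_itv/= leey andbT le_max; apply/orP; left.
    by rewrite unlock integral_ge0// => w _; rewrite lee_fin expR_ge0.
  rewrite le_max; apply/orP; left; rewrite -momE unlock le_eqVlt; apply/orP; left; apply/eqP.
  apply: eq_integral => w _; congr EFin; rewrite /th -expRM; congr expR.
  by rewrite mulNr mulrC mulrA.
pose S n := (limn (series b) - series b n) `^ q.
have series_bound (U : nat -> T -> R) B x n :
    (forall i, measurable_fun setT (U i)) -> (forall i w, 0 <= U i w) ->
    (forall i, indep_pair P (U i) (th i)) -> 0 <= B ->
    (forall i y, tail P (U i) y <= B * FA y) -> x0 <= x ->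
    (P (\bigcup_N [set w | (x < \sum_(n <= i < N) U i w * th i w)%R]) <=
      (layer_sum p q * (B * Cl * Cu) * FA x * S n)%:E)%E.
  move=> mU U0 iU B0 UB xx.
  apply: (tail_series_le mth th01 FA0 pq' (ltW q10) q_ge1 x00 (ltW Cu0) (ltW Cl0) GCu GCl) => //.
  by move=> N; exact: series_tail_le.
pose K := layer_sum p q * (1 * Cl * Cu).
have K0 : 0 <= K.
  rewrite /K mul1r; apply: mulr_ge0; last by rewrite mulr_ge0 ?(ltW Cl0) ?(ltW Cu0).
  exact: layer_sum_ge0 (ltW pq).
have W_bound x n : x0 <= x ->
    (P (\bigcup_N [set w | (x < \sum_(n <= i < N) W i w * th i w)%R]) <=
      (K * FA x * S n)%:E)%E.
  move=> xx; apply: series_bound => //; first by move=> i; exact: indep_g.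
  by move=> i y; rewrite tailW mul1r.

(* The ruin event: measurability and upper bound *)
have ruinE x : ruin x = P [set w | (embed @` dilate x A) (weighted_series X th w)] by [].
have mruin x : 0 < x -> measurable [set w | (embed @` dilate x A) (weighted_series X th w)].
  by move=> ?; apply: measurable_ruin.
have mWth i : measurable_fun setT (fun w => W i w * th i w) by exact: measurable_funM.
have ruin_le x : 0 < x ->
    (ruin x <= P (\bigcup_N [set w | (x < \sum_(0 <= i < N) W i w * th i w)%R]))%E.
  move=> x_gt0; rewrite ruinE; apply: le_measure.
  - by apply/mem_set; exact: mruin.
  - by apply/mem_set; apply: bigcup_measurable => N _; apply: measurable_superlevel;
    exact: measurable_sum.
  - move=> w /(ruin_sub_radius ruinA X0 th_gt0 x_gt0)[N xN]; by exists N.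
have ruin_fin x : 0 < x -> ruin x \is a fin_num by move=> ?; rewrite ruinE;
  apply: fin_num_measure; exact: mruin.
have V0 x : 0 < tail V idfun x by exact: (normalizing_tail_gt0 mrvF).

(* Comparison of F_A with V, and the case mu(A) = 0 *)
have [L muL limL] := mrv_ruin mrvF ruinA.
have ratioE x : 0 < x -> (ruin x / (tail V idfun x)%:E)%E = (fine (ruin x) / tail V idfun x)%:E.
  by move=> x_gt0; rewrite -{1}(fineK (ruin_fin _ x_gt0)) inver gt_eqF// -EFinM.
rewrite muL; split => [|[L0]]; last first.
  rewrite /asymp_negligible.
  have h : fine (ruin x) / tail V idfun x @[x --> +oo] --> (0 : R).
    apply: (@squeeze_cvgr _ _ _ _ (cst 0) (fun x => K * S 0%N * (FA x / tail V idfun x))).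
    - near=> x.
      have xx0 : x0 <= x by near: x; exact: (nbhs_pinfty_ge (num_real x0)).
      have x_gt0 : 0 < x by exact: lt_le_trans xx0.
      rewrite /= divr_ge0 ?fine_ge0 ?(ltW (V0 _))//= mulrA ler_wpM2r ?invr_ge0 ?(ltW (V0 _))//.
      rewrite -lee_fin fineK ?ruin_fin// (le_trans (ruin_le _ x_gt0))//.
      by rewrite mulrAC W_bound.
    - exact: cvg_cst.
    - by rewrite -(mulr0 (K * S 0%N)) -L0; apply: cvgM => //; exact: cvg_cst.
  have : (fine (ruin x) / tail V idfun x)%:E @[x --> +oo] --> 0%:E.
    by apply: cvg_EFin => //; exact: nearW.
  apply: cvg_trans; apply: near_eq_cvg; near=> x.
  by rewrite ratioE//; near: x; exact: nbhs_pinfty_gt.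

(* The case mu(A) > 0: regular variation of F_A and the limiting constant *)
move=> L0; have {L0}Lgt0 : 0 < L.
  rewrite lt_def; apply/andP; split; first by apply: contra_neq L0 => ->.
  by rewrite -lee_fin -muL.
have alpha0 : 0 < alpha by case: mrvF.
have rvV : regularly_varying alpha (tail V idfun) by case: mrvF.
have rvFA : regularly_varying alpha FA by exact: regularly_varying_equiv FA0 V0 Lgt0 limL rvV.
pose e i := fine (\int[P]_w (th i w `^ alpha)%:E).
have momEa : forall i, (\int[P]_w (th i w `^ alpha)%:E)%E = (e i)%:E.
  by move=> i; rewrite (momentE P mth th01 (ltW alpha0)) /e /moment.
have e_gt0 i : 0 < e i by apply: (@moment_gt0 _ _ _ P th alpha) => //; exact: ltW.
(* Obtained by letting x tend to infinity in the Potter bound [GCu], whose left side divided by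
   F_A(x) converges by regular variation; this avoids comparing alpha with q1 through the
   Matuszewska index. *)
have th_le i w : th i w `^ alpha <= Cu * th i w `^ q1.
  have ti0 : 0 < (th i w)^-1 by rewrite invr_gt0.
  have -> : th i w `^ alpha = (th i w)^-1 `^ (- alpha).
    by rewrite -powR_inv1 ?(ltW (th_gt0 _ _))// -powRrM mulN1r opprK.
  apply: (cvgr_to_le (rvFA _ ti0)); near=> x.
  have xx0 : x0 <= x by near: x; exact: (nbhs_pinfty_ge (num_real x0)).
  by rewrite ler_pdivrMr// mulrC; apply: GCu.
have moment1 i : moment P th q1 i <= 1.
  rewrite -lee_fin -momE; apply: (@le_trans _ _ (\int[P]_w (cst 1%E) w)%E).
    apply: ge0_le_integral => //.
    - by move=> w _; rewrite lee_fin powR_ge0.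
    - by apply/measurable_EFinP; apply: (measurableT_comp (measurable_powR q1)).
    - move=> w _; rewrite lee_fin -[leRHS](powRr0 (th i w)).
      by apply: ger_powR; [exact: th01|exact: ltW].
  by rewrite integral_cst// mul1e probability_le1.
have e_le i : e i <= Cu * b i.
  have m0 : 0 < moment P th q1 i by apply: moment_gt0 => //; exact: ltW.
  apply: (@le_trans _ _ (Cu * moment P th q1 i)).
    rewrite -lee_fin -momEa EFinM -momE -ge0_integralZl_EFin ?(ltW Cu0)//; last 2 first.
    - by move=> w _; rewrite lee_fin powR_ge0.
    - by apply/measurable_EFinP; apply: (measurableT_comp (measurable_powR q1)).
    apply: ge0_le_integral => //.
    - by move=> w _; rewrite lee_fin powR_ge0.
    - by apply/measurable_EFinP; apply: (measurableT_comp (measurable_powR alpha)).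
    - apply: measurable_funeM; apply/measurable_EFinP.
      by apply: (measurableT_comp (measurable_powR q1)).
    - by move=> w _; rewrite -EFinM lee_fin th_le.
  (* A moment lies in (0, 1] and 1/q <= 1, so it is at most its power 1/q. *)
  rewrite ler_wpM2l ?(ltW Cu0)//; apply: ger1_powR; first by rewrite m0 moment1.
  by rewrite invf_le1// (lt_le_trans ltr01).
have ce : cvgn (series e).
  apply: (@series_le_cvg _ _ (Cu *: b)) => [i|i|i|].
  - exact: ltW.
  - by rewrite mulr_ge0// ltW.
  - exact: e_le.
  - exact: is_cvg_seriesZ.
pose I := limn (series e).
have cI : series e @ \oo --> I by exact: ce.
have I0 : 0 < I.
  apply: (lt_le_trans (e_gt0 0%N)).
  have -> : e 0%N = series e 1%N by rewrite /series/= big_nat1.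
  apply: nondecreasing_cvgn_le => //.
  by apply/nondecreasing_seqP => n; rewrite seriesSr lerDl ltW.
have integralE : integral_m = I%:E.
  rewrite /integral_m (@integral_mean_measure _ _ _ P tau (fun s => expR (- (alpha * r *
    s))))//; last first.
    apply: measurableT_comp => //; apply: measurable_funN; exact: measurable_funM.
  rewrite -(nneseries_cvg (fun i => ltW (e_gt0 i)) cI); apply: eq_eseriesr => i _.
  rewrite -momEa; apply: eq_integral => w _; congr EFin; rewrite /th -expRM; congr expR.
  by ring.
have qaiW : QAI P W by [].
have S0 : S @ \oo --> 0.
  pose u n := limn (series b) - series b n.
  have u0 : u @ \oo --> 0.
    by rewrite -(subrr (limn (series b))); apply: cvgB; [exact: cvg_cst|exact: cb].
  have u_ge0 n : 0 <= u n by have := series_tail_le n n b0 cb; rewrite big_geq.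
  apply: (@squeeze_cvgr _ _ _ _ (cst 0) u) => //; last exact: cvg_cst.
  (* Since q >= 1, the q-th power of [u n] is at most [u n] as soon as [u n <= 1]. *)
  near=> n; have u1 : u n <= 1 by near: n; exact: (cvgr_le _ u0 _ ltr01).
  rewrite powR_ge0 /= /S -/(u n); have [->|un] := eqVneq (u n) 0.
    by rewrite powR0 ?gt_eqF// (lt_le_trans ltr01).
  by apply: ge1r_powR => //; rewrite lt_def un u_ge0.
have lower := jump_lower_bound mW mth W0 th01 (fun i => indep_g _ i mrad) tailW FA0 (ltW alpha0)
  rvFA qaiW cI.
have upper := jump_upper_bound mW mth W0 th01 (fun i => indep_g _ i mrad) tailW FA0 (ltW alpha0)
  rvFA qaiW cI W_bound K0 S0.

(* Almost sure finiteness of the components *)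
pose inf j := [set w | (\sum_(0 <= i <oo) (X i w 0%R j * th i w)%:E = +oo)%E].
have mcoord j : measurable_fun setT ((fun z : 'rV[R]_d => z 0%R j) : borelRV R d -> R).
  exact: measurable_coord.
have mXj j i : measurable_fun setT (fun w => (X i w : 'rV[R]_d) 0%R j).
  exact: (measurableT_comp (mcoord j) (mX i)).
have mXth j i : measurable_fun setT (fun w => (X i w : 'rV[R]_d) 0%R j * th i w).
  exact: measurable_funM.
have Xth0 j i w : 0 <= (X i w : 'rV[R]_d) 0%R j * th i w by rewrite mulr_ge0// ltW.
have minf j : measurable (inf j) by exact: measurable_series_infinite.
(* A component is at most the sup norm, whose tail divided by V converges by [mrv_beyond]; dividing
   by F_A/V, which tends to [L > 0], bounds it by a multiple of F_A. *)
have [B B0 HB] : exists2 B, 0 <= B & forall j x, tail F (fun z : 'rV[R]_d => z 0%R j) x <= B * FA x.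
  have [l0 lim_l0 _] := mrv_beyond mrvF.
  set f0 := fun x : R => fine (F [set y : 'rV[R]_d | exists j, x < `|y 0%R j|]) in lim_l0.
  have mf0 x : measurable ([set y : 'rV[R]_d | exists j, x < `|y 0%R j|] : set (borelRV R d)).
    rewrite [X in measurable X](_ : _ =
        \bigcup_(j in [set: 'I_d]) [set y : borelRV R d | x < `|(y : 'rV[R]_d) 0%R j|]).
      apply: fin_bigcup_measurable => // j _; apply: measurable_superlevel.
      by apply: measurableT_comp => //; exact: mcoord.
    by apply/seteqP; split => y [j]; exists j.
  have f01 x : f0 x <= 1.
    by rewrite -lee_fin fineK ?fin_num_measure// probability_le1.
  have lim_f0 : f0 x / FA x @[x --> +oo] --> l0 / L.
    have h : (FA x / tail V idfun x)^-1 @[x --> +oo] --> L^-1 by apply: cvgV; rewrite ?gt_eqF.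
    apply: cvg_pinfty_ext (cvgM_pinfty lim_l0 h) => x /=.
    by rewrite invf_div mulrA divfK// gt_eqF.
  have [B B0 HB] := tail_domination f01 FA0 FAmono lim_f0.
  exists B => // j x; apply: le_trans (HB x).
  apply: fine_le; rewrite ?fin_num_measure//; first exact: measurable_superlevel.
  apply: le_measure.
  - by apply/mem_set; exact: measurable_superlevel.
  - exact/mem_set.
  - by move=> y /= xy; exists j; rewrite (lt_le_trans xy)// ler_norm.
have inf0 j : P (inf j) = 0%E.
  apply: series_infinite_null => // eps eps0.
  pose KB := layer_sum p q * (B * Cl * Cu) * S 0%N.
  have KB0 : 0 <= KB.
    apply: mulr_ge0; last exact: powR_ge0.
    apply: mulr_ge0; first exact: layer_sum_ge0 (ltW pq).
    by rewrite !mulr_ge0 ?(ltW Cl0) ?(ltW Cu0).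
  (* [KB] is only known to be nonnegative; adding 1 allows the division. *)
  have KB1 : 0 < KB + 1 by rewrite ltr_wpDl.
  have epsKB : 0 < eps / (KB + 1) by rewrite divr_gt0.
  have [x xx0 FAx] := potter_vanish q10 Cu0 x00 FA1 FA0 GCu epsKB.
  exists x; apply: le_trans (@series_bound (fun i w => X i w 0%R j) B x 0%N _ _ _ B0 _ xx0) _ => //.
  - by move=> i; exact: (indep_g (fun z : 'rV[R]_d => z 0 j) i (mcoord j)).
  - by move=> i y; rewrite (tail_g (fun z : 'rV[R]_d => z 0 j) i (mcoord j)).
  rewrite lee_fin mulrAC -/KB (le_trans (ler_wpM2l KB0 FAx))//.
  by rewrite mulrA ler_pdivrMr// mulrC ler_wpM2l ?(ltW eps0)// lerDl.
pose NF := \bigcup_(j in [set: 'I_d]) inf j.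
have mNF : measurable NF by apply: fin_bigcup_measurable.
have NF0 : P NF = 0%E.
  apply/eqP; rewrite eq_le measure_ge0 andbT.
  apply: le_trans (@measure_sub_seq _ _ _ P _ (enum 'I_d) inf NF mNF minf _) _.
    by move=> w [j _ wj]; exists j; rewrite ?mem_enum.
  by rewrite big1 => [|j _]; [|exact: inf0].

(* Lower bound for the ruin event and conclusion *)
have mjump x : measurable (\bigcup_i [set w | x < W i w * th i w]).
  by apply: bigcup_measurable => i _; exact: measurable_superlevel.
have ruin_ge x : 0 < x -> (P (\bigcup_i [set w | (x < W i w * th i w)%R]) <= ruin x)%E.
  move=> x_gt0; rewrite (measureDI _ (mjump x) (mruin x x_gt0)).
  rewrite [X in (X + _)%E](_ : _ = 0%E) ?add0e.
    rewrite ruinE; apply: le_measure; [| |exact: subIsetr]; apply/mem_set; last exact: mruin.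
    by apply: measurableI => //; exact: mruin.
  apply/eqP; rewrite eq_le measure_ge0 andbT -NF0; apply: le_measure.
  - by apply/mem_set; apply: measurableD => //; exact: mruin.
  - exact/mem_set.
  (* A jump over x without ruin forces an infinite component, so this difference lies in the null
     set [NF]. *)
  - move=> w [[i _ /= xi] nruin]; apply: contrapT => nNF; apply: nruin.
    apply: (radius_sub_ruin ruinA X0 th_gt0 x_gt0 _ xi) => j.
    rewrite ltey; apply/eqP => wj; apply: nNF; exists j => //=.
    by rewrite /inf /= -wj mxE.
have lim_ruin : fine (ruin x) / FA x @[x --> +oo] --> I.
  apply/cvgrPdist_le => eps eps0; near=> x.
  have x_gt0 : 0 < x by near: x; exact: nbhs_pinfty_gt.
  have h1 : (((I - eps) * FA x)%:E <= ruin x)%E.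
    by apply: le_trans (ruin_ge x x_gt0); near: x; exact: lower.
  have h2 : (ruin x <= ((I + eps) * FA x)%:E)%E.
    by apply: le_trans (ruin_le x x_gt0) _; near: x; exact: upper.
  move: h1 h2; rewrite -(fineK (ruin_fin x x_gt0)) !lee_fin => h1 h2.
  have h3 : I - eps <= fine (ruin x) / FA x by rewrite ler_pdivlMr.
  have h4 : fine (ruin x) / FA x <= I + eps by rewrite ler_pdivrMr.
  by rewrite ler_distlC h3 h4.
have LI : L * I != 0 by rewrite mulf_neq0// gt_eqF.
have lim1 : fine (ruin x) / tail V idfun x * (L * I)^-1 @[x --> +oo] --> (1 : R).
  rewrite -(divff LI); apply: cvgM; last exact: cvg_cst.
  rewrite mulrC; apply: cvg_pinfty_ext (cvgM_pinfty lim_ruin limL) => x /=.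
  by rewrite mulrA divfK// gt_eqF.
have : (fine (ruin x) / tail V idfun x * (L * I)^-1)%:E @[x --> +oo] --> 1%:E.
  by apply: cvg_EFin => //; exact: nearW.
apply: cvg_trans; apply: near_eq_cvg; near=> x.
have x_gt0 : 0 < x by near: x; exact: nbhs_pinfty_gt.
rewrite integralE -!EFinM inver; case: eqP => [/eqP|_].
  by rewrite !mulf_eq0 !gt_eqF.
rewrite -(fineK (ruin_fin x x_gt0)) -EFinM /=; congr EFin.
by rewrite !invfM; ring.
Unshelve. all: end_near.
Qed.
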